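(* Let $\mathcal P$ be a locally trivial quantum principal fibre bundle whose structure group is a compact quantum group $G$, i.e. $H=P(G)$. The set of left (right) gauge transformations on $\mathcal P$ is in one-to-one correspondence with sets of invertible $B_i$-valued matrices $(b^{\alpha}_{i_{kl}})_{k,l=1,\dots,N^\alpha}$, $\alpha\in M/\!\sim$ (one matrix for each $i\in I$ and each $\alpha$), satisfying $$\pi^i_j(b^{\alpha}_{i_{kl}})=\sum_{m,n=1}^{N^\alpha}\tau_{ij}(u^\alpha_{km})\,\pi^j_i(b^\alpha_{j_{mn}})\,\tau_{ji}(u^\alpha_{nl}).$$
   Context: Algebras are unital and associative over $\mathbb C$. A covering of an algebra $B$ is a finite family $(J_i)_{i\in I}$ of two-sided ideals with $\bigcap_i J_i=0$; put $B_i=B/J_i$, $B_{ij}=B/(J_i+J_j)$, with quotient maps $\pi_i:B\to B_i$, $\pi^i_j:B_i\to B_{ij}$. The covering is complete if $b\mapsto(\pi_i(b))_i$ maps $B$ onto $\{(b_i)\mid \pi^i_j(b_i)=\pi^j_i(b_j)\ \forall i,j\}$. A locally trivial quantum principal fibre bundle (QPFB) consists of an algebra $B$ with complete covering $(J_i)_{i\in I}$, a Hopf algebra $H$, a right $H$-comodule algebra $\mathcal P$ with coaction $\Delta_{\mathcal P}$, an injective homomorphism $\iota:B\to\mathcal P$, and surjective homomorphisms $\chi_i:\mathcal P\to B_i\otimes H$ such that $\chi_i(\iota(b))=\pi_i(b)\otimes 1$, $(\chi_i\otimes id)\circ\Delta_{\mathcal P}=(id\otimes\Delta)\circ\chi_i$,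 and $(\ker\chi_i)_{i}$ is a complete covering of $\mathcal P$. There are then isomorphisms $\phi_{ij}$ of $B_{ij}\otimes H$ with $(\pi^i_j\otimes id)\circ\chi_i=\phi_{ij}\circ(\pi^j_i\otimes id)\circ\chi_j$, and $\phi_{ij}(a\otimes h)=\sum a\,\tau_{ji}(h_1)\otimes h_2$, where the transition functions $\tau_{ij}:H\to B_{ij}$ are homomorphisms with values in the center of $B_{ij}$ and $\tau_{ji}=\tau_{ij}\circ S$. A left (right) gauge transformation on $B_i\otimes H$ is an isomorphism $\alpha$ of left (right) $(B_i\otimes 1)$-modules of $B_i\otimes H$ with $(\alpha\otimes id)\circ(id\otimes\Delta)=(id\otimes\Delta)\circ\alpha$ and $\alpha(a\otimes1)=a\otimes 1$. A left (right) gauge transformation on $\mathcal P$ is an isomorphism $\alpha_{l}$ ($\alpha_r$) of left (right) $\iota(B)$-modules of $\mathcal P$ such that for each $i$ there is a left (right) gauge transformation $\alpha_{l,r_i}$ on $B_i\otimes H$ with $\chi_i\circ\alpha_{l,r}=\alpha_{l,r_i}\circ\chi_i$. $P(G)$ is the Hopf $*$-algebra of polynomial functions on $G$, with antipode $S$. $M$ is the set of irreducible unitary matrix co-representations, i.e. matrices $(u_{ij})_{i,j=1}^N$ over $P(G)$ with $\Delta(u_{ij})=\sum_ku_{ik}\otimes u_{kj}$, $u_{ij}^*=S(u_{ji})$; $\sim$ is equivalence via intertwiners; in each class $\alpha\in M/\!\sim$ a representative $(u^\alpha_{kl})_{k,l=1,\dots,N^\alpha}$ is fixed. The elements $u^\alpha_{kl}$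 form a linear basis of $P(G)$.
   Formalization: The matrices of the trivial co-representation are required to be 1, as α(a⊗1)=a⊗1 forces; without this the claim fails (G trivial, B=C: one gauge transformation, but C^* many families). The transition functions, which the bundle axioms alone do not guarantee, are taken as given. *)

(* Defs.v *)
From HB Require Import structures.
From mathcomp Require Import all_boot all_order all_algebra.
From mathcomp Require Import mathcomp_extra boolp classical_sets functions.
From mathcomp Require Import reals.
From mathcomp Require Import complex.

Set Implicit Arguments.
Unset Strict Implicit.
Unset Printing Implicit Defensive.

Import Order.TTheory GRing.Theory Num.Theory.

Local Open Scope ring_scope.
Local Open Scope quotient_scope.

(* MathComp's [algType K] only has nontrivial rings.  The quotients of an     *)
(* algebra by an arbitrary two-sided ideal, such as B / (J_i + J_j), may be   *)
(* the zero algebra, hence this structure of a unital associative K-algebra,  *)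
(* possibly zero.  It is declared over [lmodType] with its own product, which *)
(* then provides the [pzRingType] structure, because Hierarchy Builder does   *)
(* not accept a join of [lmodType] and [pzRingType] above [lalgType].         *)
HB.mixin Record Lmodule_isPzAlg (K : fieldType) A of GRing.Lmodule K A := {
  alg_one : A;
  alg_mul : A -> A -> A;
  alg_mulA : associative alg_mul;
  alg_mul1r : left_id alg_one alg_mul;
  alg_mulr1 : right_id alg_one alg_mul;
  alg_mulDl : left_distributive alg_mul +%R;
  alg_mulDr : right_distributive alg_mul +%R;
  alg_scaleAl : forall (k : K) x y, k *: alg_mul x y = alg_mul (k *: x) y;
  alg_scaleAr : forall (k : K) x y, k *: alg_mul x y = alg_mul x (k *: y)
}.

#[short(type="pzAlgType")]
HB.structure Definition PzAlg (K : fieldType) :=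
  { A of GRing.Lmodule K A & Lmodule_isPzAlg K A }.

HB.instance Definition _ (K : fieldType) (A : pzAlgType K) :=
  GRing.Zmodule_isPzRing.Build (PzAlg.sort A)
    (@alg_mulA K A) (@alg_mul1r K A) (@alg_mulr1 K A) (@alg_mulDl K A)
    (@alg_mulDr K A).

Section PzAlgTheory.

Context (K : fieldType) (A : pzAlgType K).

Lemma alg_scalerAl (k : K) (x y : A) : k *: (x * y) = (k *: x) * y.
Proof. exact: alg_scaleAl. Qed.

Lemma alg_scalerAr (k : K) (x y : A) : k *: (x * y) = x * (k *: y).
Proof. exact: alg_scaleAr. Qed.

End PzAlgTheory.

Section LinearFun.

Context (K : fieldType) (U V : lmodType K) (f : U -> V).
Context (flin : linear f).

Lemma linear_funD x y : f (x + y) = f x + f y.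
Proof. by rewrite -[x]scale1r flin !scale1r. Qed.

Lemma linear_fun0 : f 0 = 0.
Proof. by apply: (addIr (f 0)); rewrite -linear_funD !add0r. Qed.

Lemma linear_funZ k x : f (k *: x) = k *: f x.
Proof. by rewrite -[k *: x]addr0 flin linear_fun0 addr0. Qed.

End LinearFun.

Record alg_hom (K : fieldType) (A B : pzAlgType K) := AlgHom {
  alg_hom_fun :> A -> B;
  alg_hom_linear : linear alg_hom_fun;
  alg_hom_monoid : monoid_morphism alg_hom_fun
}.

HB.instance Definition _ (K : fieldType) (A B : pzAlgType K) (f : alg_hom A B) :=
  GRing.isLinear.Build K A B *:%R f (alg_hom_linear f).
HB.instance Definition _ (K : fieldType) (A B : pzAlgType K) (f : alg_hom A B) :=
  GRing.isMonoidMorphism.Build A B f (alg_hom_monoid f).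

Definition surj (A B : Type) (f : A -> B) : Prop := forall y, exists x, f x = y.

Section Quotient.

Context (K : fieldType) (A : pzAlgType K).

Record ideal := Ideal {
  ideal_set :> A -> Prop;
  ideal0 : ideal_set 0;
  idealD : forall x y, ideal_set x -> ideal_set y -> ideal_set (x + y);
  idealMl : forall a x, ideal_set x -> ideal_set (a * x);
  idealMr : forall a x, ideal_set x -> ideal_set (x * a)
}.

Context (J : ideal).

Lemma idealN x : J x -> J (- x).
Proof. by move=> Jx; rewrite -mulN1r; exact: idealMl. Qed.

Lemma idealZ (k : K) x : J x -> J (k *: x).
Proof. by move=> Jx; rewrite -[x]mul1r alg_scalerAl; exact: idealMl. Qed.

Definition ideal_eqv (x y : A) : bool := `[< J (x - y) >].

Lemma ideal_eqv_refl : reflexive ideal_eqv.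
Proof. by move=> x; apply/asboolP; rewrite subrr; exact: ideal0. Qed.

Lemma ideal_eqv_sym : symmetric ideal_eqv.
Proof.
by move=> x y; apply/asboolP/asboolP => /idealN; rewrite opprB.
Qed.

Lemma ideal_eqv_trans : transitive ideal_eqv.
Proof.
move=> y x z /asboolP xy /asboolP yz; apply/asboolP.
by rewrite -(subrKA y); exact: idealD.
Qed.

Canonical ideal_equiv_rel :=
  EquivRel ideal_eqv ideal_eqv_refl ideal_eqv_sym ideal_eqv_trans.

Definition quot : Type := {eq_quot ideal_eqv}.

HB.instance Definition _ := EqQuotient.on quot.
HB.instance Definition _ := Choice.on quot.

Definition quot_pi (x : A) : quot := \pi_quot x.

Lemma quot_piP x y : quot_pi x = quot_pi y <-> J (x - y).
Proof.
split; first by move=> /eqmodP /asboolP.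
by move=> Jxy; apply/eqmodP/asboolP.
Qed.

Lemma quot_ind (P : quot -> Prop) : (forall x, P (quot_pi x)) -> forall x, P x.
Proof. by move=> Ppi; elim/quotW. Qed.

Lemma quot_repr x : J (repr (quot_pi x) - x).
Proof. by apply/quot_piP; rewrite /quot_pi reprK. Qed.

Definition quot_add (x y : quot) := quot_pi (repr x + repr y).
Definition quot_opp (x : quot) := quot_pi (- repr x).
Definition quot_mul (x y : quot) := quot_pi (repr x * repr y).
Definition quot_scale (k : K) (x : quot) := quot_pi (k *: repr x).

Lemma quot_addE x y : quot_add (quot_pi x) (quot_pi y) = quot_pi (x + y).
Proof.
by apply/quot_piP; rewrite opprD addrACA; apply: idealD; exact: quot_repr.
Qed.

Lemma quot_oppE x : quot_opp (quot_pi x) = quot_pi (- x).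
Proof. by apply/quot_piP; rewrite -opprD; apply: idealN; exact: quot_repr. Qed.

Lemma quot_mulE x y : quot_mul (quot_pi x) (quot_pi y) = quot_pi (x * y).
Proof.
apply/quot_piP; set x' := repr _; set y' := repr _.
rewrite -(subrKA (x * y')) -mulrBl -mulrBr.
by apply: idealD; [apply: idealMr|apply: idealMl]; exact: quot_repr.
Qed.

Lemma quot_scaleE k x : quot_scale k (quot_pi x) = quot_pi (k *: x).
Proof. by apply/quot_piP; rewrite -scalerBr; apply: idealZ; exact: quot_repr. Qed.

Lemma quot_addA : associative quot_add.
Proof.
move=> x y z; elim/quot_ind: x => x; elim/quot_ind: y => y; elim/quot_ind: z => z.
by rewrite !quot_addE addrA.
Qed.

Lemma quot_addC : commutative quot_add.
Proof.
by elim/quot_ind=> x; elim/quot_ind=> y; rewrite !quot_addE addrC.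
Qed.

Lemma quot_add0 : left_id (quot_pi 0) quot_add.
Proof. by elim/quot_ind=> x; rewrite quot_addE add0r. Qed.

Lemma quot_addN : left_inverse (quot_pi 0) quot_opp quot_add.
Proof. by elim/quot_ind=> x; rewrite quot_oppE quot_addE addNr. Qed.

HB.instance Definition _ :=
  GRing.isZmodule.Build quot quot_addA quot_addC quot_add0 quot_addN.

Lemma quot_piD x y : quot_pi (x + y) = quot_pi x + quot_pi y.
Proof. by rewrite -quot_addE. Qed.

Lemma quot_mulA : associative quot_mul.
Proof.
move=> x y z; elim/quot_ind: x => x; elim/quot_ind: y => y; elim/quot_ind: z => z.
by rewrite !quot_mulE mulrA.
Qed.

Lemma quot_mul1l : left_id (quot_pi 1) quot_mul.
Proof. by elim/quot_ind=> x; rewrite quot_mulE mul1r. Qed.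

Lemma quot_mul1r : right_id (quot_pi 1) quot_mul.
Proof. by elim/quot_ind=> x; rewrite quot_mulE mulr1. Qed.

Lemma quot_mulDl : left_distributive quot_mul +%R.
Proof.
move=> x y z; elim/quot_ind: x => x; elim/quot_ind: y => y; elim/quot_ind: z => z.
by rewrite !(=^~ quot_piD, quot_mulE) mulrDl.
Qed.

Lemma quot_mulDr : right_distributive quot_mul +%R.
Proof.
move=> x y z; elim/quot_ind: x => x; elim/quot_ind: y => y; elim/quot_ind: z => z.
by rewrite !(=^~ quot_piD, quot_mulE) mulrDr.
Qed.

Lemma quot_scaleA k l x : quot_scale k (quot_scale l x) = quot_scale (k * l) x.
Proof. by elim/quot_ind: x => x; rewrite !quot_scaleE scalerA. Qed.

Lemma quot_scale1 : left_id 1 quot_scale.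
Proof. by elim/quot_ind=> x; rewrite quot_scaleE scale1r. Qed.

Lemma quot_scaleDr : right_distributive quot_scale +%R.
Proof.
move=> k x y; elim/quot_ind: x => x; elim/quot_ind: y => y.
by rewrite !(=^~ quot_piD, quot_scaleE) scalerDr.
Qed.

Lemma quot_scaleDl x : {morph quot_scale^~ x : k l / k + l}.
Proof.
by elim/quot_ind: x => x k l; rewrite !(=^~ quot_piD, quot_scaleE) scalerDl.
Qed.

HB.instance Definition _ := GRing.Zmodule_isLmodule.Build K quot
  quot_scaleA quot_scale1 quot_scaleDr quot_scaleDl.

Lemma quot_piZ k x : quot_pi (k *: x) = k *: quot_pi x.
Proof. by rewrite -quot_scaleE. Qed.

Lemma quot_scaleAl k x y : k *: quot_mul x y = quot_mul (k *: x) y.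
Proof.
elim/quot_ind: x => x; elim/quot_ind: y => y.
by rewrite !(=^~ quot_piZ, quot_mulE) alg_scalerAl.
Qed.

Lemma quot_scaleAr k x y : k *: quot_mul x y = quot_mul x (k *: y).
Proof.
elim/quot_ind: x => x; elim/quot_ind: y => y.
by rewrite !(=^~ quot_piZ, quot_mulE) alg_scalerAr.
Qed.

HB.instance Definition _ := Lmodule_isPzAlg.Build K quot quot_mulA quot_mul1l
  quot_mul1r quot_mulDl quot_mulDr quot_scaleAl quot_scaleAr.
HB.instance Definition _ := GRing.PzRing.copy quot (PzAlg.sort quot).

Lemma quot_pi_linear : linear quot_pi.
Proof. by move=> k x y; rewrite -quot_addE -quot_scaleE. Qed.

Lemma quot_pi_monoid : monoid_morphism quot_pi.
Proof. by split=> // x y; rewrite -quot_mulE. Qed.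

Definition quot_proj : alg_hom A quot := AlgHom quot_pi_linear quot_pi_monoid.

End Quotient.

(* The map A / J -> A / L induced by the identity of A; only meaningful when  *)
(* J is included in L, and then independent of the representative.            *)
Definition quot_map (K : fieldType) (A : pzAlgType K) (J L : ideal A)
  (x : quot J) : quot L := quot_pi L (repr x).

Lemma quot_mapE (K : fieldType) (A : pzAlgType K) (J L : ideal A) (x : A) :
  (forall y, J y -> L y) -> quot_map L (quot_pi J x) = quot_pi L x.
Proof. by move=> JL; apply/quot_piP/JL; exact: quot_repr. Qed.

Section IdealSum.

Context (K : fieldType) (A : pzAlgType K) (J L : ideal A).

Definition ideal_sum_set (x : A) : Prop :=
  exists y z, [/\ J y, L z & x = y + z].

Lemma ideal_sum0 : ideal_sum_set 0.
Proof. by exists 0, 0; split; [exact: ideal0|exact: ideal0|rewrite addr0]. Qed.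

Lemma ideal_sumD x y : ideal_sum_set x -> ideal_sum_set y -> ideal_sum_set (x + y).
Proof.
move=> [a [b [Ja Lb ->]]] [c [d [Jc Ld ->]]]; exists (a + c), (b + d).
by split; [exact: idealD|exact: idealD|rewrite addrACA].
Qed.

Lemma ideal_sumMl a x : ideal_sum_set x -> ideal_sum_set (a * x).
Proof.
move=> [b [c [Jb Lc ->]]]; exists (a * b), (a * c).
by split; [exact: idealMl|exact: idealMl|rewrite mulrDr].
Qed.

Lemma ideal_sumMr a x : ideal_sum_set x -> ideal_sum_set (x * a).
Proof.
move=> [b [c [Jb Lc ->]]]; exists (b * a), (c * a).
by split; [exact: idealMr|exact: idealMr|rewrite mulrDl].
Qed.

Definition ideal_sum : ideal A :=
  Ideal ideal_sum0 ideal_sumD ideal_sumMl ideal_sumMr.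

End IdealSum.

Section Kernel.

Context (K : fieldType) (A B : pzAlgType K) (f : alg_hom A B).

Definition ker_set (x : A) : Prop := f x = 0.

Lemma ker0 : ker_set 0. Proof. exact: raddf0. Qed.

Lemma kerD x y : ker_set x -> ker_set y -> ker_set (x + y).
Proof. by rewrite /ker_set raddfD /= => -> ->; rewrite addr0. Qed.

Lemma kerMl a x : ker_set x -> ker_set (a * x).
Proof. by rewrite /ker_set rmorphM /= => ->; rewrite mulr0. Qed.

Lemma kerMr a x : ker_set x -> ker_set (x * a).
Proof. by rewrite /ker_set rmorphM /= => ->; rewrite mul0r. Qed.

Definition ker_ideal : ideal A := Ideal ker0 kerD kerMl kerMr.

End Kernel.

Section Tensor.

Context (K : fieldType) (V W : lmodType K).

(* A finite formal sum of elementary tensors v (x) w is a list of pairs.  The *)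
(* relation is the least congruence making concatenation commutative and      *)
(* (v, w) |-> [:: (v, w)] bilinear.                                           *)
Inductive tens_eqv : seq (V * W) -> seq (V * W) -> Prop :=
| TensRefl s : tens_eqv s s
| TensSym s t : tens_eqv s t -> tens_eqv t s
| TensTrans s t r : tens_eqv s t -> tens_eqv t r -> tens_eqv s r
| TensCat s s' t t' : tens_eqv s s' -> tens_eqv t t' -> tens_eqv (s ++ t) (s' ++ t')
| TensComm s t : tens_eqv (s ++ t) (t ++ s)
| TensAddl v v' w : tens_eqv [:: (v + v', w)] [:: (v, w); (v', w)]
| TensAddr v w w' : tens_eqv [:: (v, w + w')] [:: (v, w); (v, w')]
| TensScale k v w : tens_eqv [:: (k *: v, w)] [:: (v, k *: w)]
| TensZero w : tens_eqv [:: (0, w)] [::].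

Definition tens_eqvb s t : bool := `[< tens_eqv s t >].

Lemma tens_eqv_refl : reflexive tens_eqvb.
Proof. by move=> s; apply/asboolP; exact: TensRefl. Qed.

Lemma tens_eqv_sym : symmetric tens_eqvb.
Proof. by move=> s t; apply/asboolP/asboolP; exact: TensSym. Qed.

Lemma tens_eqv_trans : transitive tens_eqvb.
Proof.
by move=> t s r /asboolP st /asboolP tr; apply/asboolP; exact: TensTrans tr.
Qed.

Canonical tens_equiv_rel :=
  EquivRel tens_eqvb tens_eqv_refl tens_eqv_sym tens_eqv_trans.

Definition tensor : Type := {eq_quot tens_eqvb}.

HB.instance Definition _ := EqQuotient.on tensor.
HB.instance Definition _ := Choice.on tensor.

Definition tens_pi (s : seq (V * W)) : tensor := \pi_tensor s.
Definition tens (v : V) (w : W) : tensor := tens_pi [:: (v, w)].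

Lemma tens_piP s t : tens_pi s = tens_pi t <-> tens_eqv s t.
Proof.
split; first by move=> /eqmodP /asboolP.
by move=> st; apply/eqmodP/asboolP.
Qed.

Lemma tens_quotind (P : tensor -> Prop) :
  (forall s, P (tens_pi s)) -> forall x, P x.
Proof. by move=> Ppi; elim/quotW. Qed.

Lemma tens_repr s : tens_eqv (repr (tens_pi s)) s.
Proof. by apply/tens_piP; rewrite /tens_pi reprK. Qed.

Definition tens_add (x y : tensor) := tens_pi (repr x ++ repr y).

Lemma tens_addE s t : tens_add (tens_pi s) (tens_pi t) = tens_pi (s ++ t).
Proof. by apply/tens_piP/TensCat; exact: tens_repr. Qed.

Lemma tens_addA : associative tens_add.
Proof.
elim/tens_quotind=> s; elim/tens_quotind=> t; elim/tens_quotind=> r.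
by rewrite !tens_addE catA.
Qed.

Lemma tens_addC : commutative tens_add.
Proof.
elim/tens_quotind=> s; elim/tens_quotind=> t; rewrite !tens_addE.
exact/tens_piP/TensComm.
Qed.

Lemma tens_add0 : left_id (tens_pi [::]) tens_add.
Proof. by elim/tens_quotind=> s; rewrite tens_addE. Qed.

Lemma tens_eqv_map k s t : tens_eqv s t ->
  tens_eqv [seq (k *: p.1, p.2) | p <- s] [seq (k *: p.1, p.2) | p <- t].
Proof.
elim=> {s t} [s|s t _|s t r _ st _ tr|s s' t t' _ ss' _ tt'|s t|v v' w|v w w'
  |l v w|w] /=.
- exact: TensRefl.
- exact: TensSym.
- exact: TensTrans tr.
- by rewrite !map_cat; exact: TensCat.
- by rewrite !map_cat; exact: TensComm.
- by rewrite scalerDr; exact: TensAddl.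
- exact: TensAddr.
- by rewrite scalerA mulrC -scalerA; exact: TensScale.
- by rewrite scaler0; exact: TensZero.
Qed.

Definition tens_scale k (x : tensor) :=
  tens_pi [seq (k *: p.1, p.2) | p <- repr x].

Lemma tens_scaleE k s :
  tens_scale k (tens_pi s) = tens_pi [seq (k *: p.1, p.2) | p <- s].
Proof. by apply/tens_piP/tens_eqv_map; exact: tens_repr. Qed.

Lemma tens_scaleDl x k l :
  tens_scale (k + l) x = tens_add (tens_scale k x) (tens_scale l x).
Proof.
elim/tens_quotind: x => s; rewrite !tens_scaleE tens_addE; apply/tens_piP.
elim: s => [|[v w] s IHs] /=; first exact: TensRefl.
rewrite scalerDl.
apply: TensTrans (TensCat (TensAddl _ _ _) IHs) _ => /=.
apply: (TensCat (TensRefl [:: (k *: v, w)])).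
rewrite -cat1s -[X in tens_eqv _ (_ ++ X)]cat1s !catA.
by apply: TensCat; [exact: TensComm|exact: TensRefl].
Qed.

Lemma tens_scale0 x : tens_scale 0 x = tens_pi [::].
Proof.
elim/tens_quotind: x => s; rewrite tens_scaleE; apply/tens_piP.
elim: s => [|[v w] s IHs] /=; first exact: TensRefl.
by rewrite scale0r -cat1s; exact: TensCat (TensZero w) IHs.
Qed.

Lemma tens_scale1 : left_id 1 tens_scale.
Proof.
elim/tens_quotind=> s; rewrite tens_scaleE; congr tens_pi.
by rewrite -[RHS]map_id; apply: eq_map => -[v w] /=; rewrite scale1r.
Qed.

Lemma tens_addN : left_inverse (tens_pi [::]) (tens_scale (-1)) tens_add.
Proof.
move=> x; rewrite -[X in tens_add _ X]tens_scale1 -tens_scaleDl addNr.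
exact: tens_scale0.
Qed.

HB.instance Definition _ :=
  GRing.isZmodule.Build tensor tens_addA tens_addC tens_add0 tens_addN.

Lemma tens_pi_cat s t : tens_pi (s ++ t) = tens_pi s + tens_pi t.
Proof. by rewrite -tens_addE. Qed.

Lemma tens_scaleA k l x : tens_scale k (tens_scale l x) = tens_scale (k * l) x.
Proof.
elim/tens_quotind: x => s; rewrite !tens_scaleE -map_comp; congr tens_pi.
by apply: eq_map => -[v w] /=; rewrite scalerA.
Qed.

Lemma tens_scaleDr : right_distributive tens_scale +%R.
Proof.
move=> k x y; elim/tens_quotind: x => s; elim/tens_quotind: y => t.
by rewrite !(=^~ tens_pi_cat, tens_scaleE) map_cat tens_pi_cat.
Qed.

HB.instance Definition _ := GRing.Zmodule_isLmodule.Build K tensor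
  tens_scaleA tens_scale1 tens_scaleDr tens_scaleDl.

Lemma tens_pi_sum s : tens_pi s = \sum_(p <- s) tens p.1 p.2.
Proof.
elim: s => [|[v w] s IHs]; first by rewrite big_nil.
by rewrite big_cons -IHs -cat1s; symmetry; exact: tens_addE.
Qed.

Lemma tens_sum x : x = \sum_(p <- repr x) tens p.1 p.2.
Proof. by rewrite -tens_pi_sum /tens_pi reprK. Qed.

Lemma tens_ind (P : tensor -> Prop) :
    P 0 -> (forall x y, P x -> P y -> P (x + y)) -> (forall v w, P (tens v w)) ->
  forall x, P x.
Proof. by move=> P0 PD Pt x; rewrite (tens_sum x); elim/big_ind: _. Qed.

Lemma tens_linearl w : linear (tens^~ w).
Proof.
move=> k v v'; rewrite /= (_ : k *: tens v w = tens (k *: v) w).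
  by rewrite /tens; apply: etrans (esym (tens_addE _ _)); exact/tens_piP/TensAddl.
exact: tens_scaleE.
Qed.

Lemma tens_linearr v : linear (tens v).
Proof.
move=> k w w'; rewrite /= (_ : k *: tens v w = tens v (k *: w)).
  by rewrite /tens; apply: etrans (esym (tens_addE _ _)); exact/tens_piP/TensAddr.
by rewrite [LHS]tens_scaleE; exact/tens_piP/TensScale.
Qed.

Definition bilinear_map (U : lmodType K) (f : V -> W -> U) : Prop :=
  (forall w, linear (f^~ w)) /\ (forall v, linear (f v)).

(* The linear map v (x) w |-> f v w, for a bilinear f; for other f the value  *)
(* depends on the chosen representative and is never used.                    *)
Definition tens_lift (U : lmodType K) (f : V -> W -> U) (x : tensor) : U :=
  \sum_(p <- repr x) f p.1 p.2.

Lemma tens_lift_pi (U : lmodType K) (f : V -> W -> U) s :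
  bilinear_map f -> tens_lift f (tens_pi s) = \sum_(p <- s) f p.1 p.2.
Proof.
move=> [fl fr]; have := tens_repr s; rewrite /tens_lift; move: (repr _) => t.
elim=> {s t} [//|s t _ ->//|s t r _ -> _ ->//|s s' t t' _ ss' _ tt'|s t
  |v v' w|v w w'|k v w|w].
- by rewrite !big_cat ss' tt'.
- by rewrite !big_cat /= addrC.
- by rewrite !big_cons !big_nil /= !addr0 (linear_funD (fl w)).
- by rewrite !big_cons !big_nil /= !addr0 (linear_funD (fr v)).
- by rewrite !big_cons !big_nil /= !addr0 (linear_funZ (fl w)) (linear_funZ (fr v)).
- by rewrite big_cons !big_nil addr0 (linear_fun0 (fl w)).
Qed.

Lemma tens_liftE (U : lmodType K) (f : V -> W -> U) v w :
  bilinear_map f -> tens_lift f (tens v w) = f v w.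
Proof. by move=> fbil; rewrite tens_lift_pi// big_seq1. Qed.

Lemma tens_lift_linear (U : lmodType K) (f : V -> W -> U) :
  bilinear_map f -> linear (tens_lift f).
Proof.
move=> fbil k x y; elim/tens_quotind: x => s; elim/tens_quotind: y => t.
have -> : k *: tens_pi s + tens_pi t
    = tens_pi ([seq (k *: p.1, p.2) | p <- s] ++ t).
  by rewrite -tens_addE -tens_scaleE.
rewrite !tens_lift_pi// big_cat big_map/=; congr (_ + _).
rewrite scaler_sumr; apply: eq_bigr => -[v w] _ /=.
exact: (linear_funZ (fbil.1 w)).
Qed.

Lemma tens_ext (U : lmodType K) (f g : tensor -> U) :
    linear f -> linear g -> (forall v w, f (tens v w) = g (tens v w)) -> f =1 g.
Proof.
move=> flin glin fg; elim/tens_ind=> [|x y xP yP|//].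
- by rewrite (linear_fun0 flin) (linear_fun0 glin).
- by rewrite (linear_funD flin) (linear_funD glin) xP yP.
Qed.

End Tensor.

Section TensorAlgebra.

Context (K : fieldType) (A B : pzAlgType K).

Local Notation T := (tensor A B).

Definition tens_mul (x y : T) : T :=
  tens_lift (fun (a : A) (b : B) =>
    tens_lift (fun (a' : A) (b' : B) => tens (a * a') (b * b')) y) x.

Lemma tens_mul_bil2 a b :
  bilinear_map (fun (a' : A) (b' : B) => tens (a * a') (b * b')).
Proof.
split=> [b'|a'] k c d /=.
- by rewrite mulrDr -alg_scalerAr [LHS]tens_linearl.
- by rewrite mulrDr -alg_scalerAr [LHS]tens_linearr.
Qed.

Lemma tens_mul_bil1 (y : T) : bilinear_map (fun (a : A) (b : B) =>
  tens_lift (fun (a' : A) (b' : B) => tens (a * a') (b * b')) y).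
Proof.
split=> [b|a] k c d /=; rewrite /tens_lift scaler_sumr -big_split /=;
  apply: eq_bigr => -[a' b'] _ /=; rewrite mulrDl -alg_scalerAl.
- exact: tens_linearl.
- exact: tens_linearr.
Qed.

Lemma tens_mulE a b a' b' :
  tens_mul (tens a b) (tens a' b') = tens (a * a') (b * b').
Proof.
rewrite /tens_mul tens_liftE; last exact: tens_mul_bil1.
by rewrite tens_liftE//; exact: tens_mul_bil2.
Qed.

Lemma tens_mulDl : left_distributive tens_mul +%R.
Proof.
by move=> x y z; exact: (linear_funD (tens_lift_linear (tens_mul_bil1 z))).
Qed.

Lemma tens_mul_scalel k x y : k *: tens_mul x y = tens_mul (k *: x) y.
Proof. by rewrite [RHS](linear_funZ (tens_lift_linear (tens_mul_bil1 y))). Qed.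

Lemma tens_mul_linearr x : linear (tens_mul x).
Proof.
move=> k y z; rewrite /tens_mul /tens_lift scaler_sumr -big_split /=.
apply: eq_bigr => -[a b] _ /=.
exact: (tens_lift_linear (tens_mul_bil2 a b)).
Qed.

Lemma tens_mulDr : right_distributive tens_mul +%R.
Proof. by move=> x y z; exact: linear_funD (tens_mul_linearr x) y z. Qed.

Lemma tens_mul0l y : tens_mul 0 y = 0.
Proof. exact: linear_fun0 (tens_lift_linear (tens_mul_bil1 y)). Qed.

Lemma tens_mul0r x : tens_mul x 0 = 0.
Proof. exact: linear_fun0 (tens_mul_linearr x). Qed.

Lemma tens_mulA : associative tens_mul.
Proof.
move=> x y z; elim/tens_ind: x => [|x x' xP x'P|a b].
- by rewrite !tens_mul0l.
- by rewrite !tens_mulDl xP x'P.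
elim/tens_ind: y => [|y y' yP y'P|a' b'].
- by rewrite tens_mul0l !tens_mul0r tens_mul0l.
- by rewrite tens_mulDl !tens_mulDr tens_mulDl yP y'P.
elim/tens_ind: z => [|z z' zP z'P|a'' b''].
- by rewrite !tens_mul0r.
- by rewrite !tens_mulDr zP z'P.
by rewrite !tens_mulE !mulrA.
Qed.

Lemma tens_mul1l : left_id (tens (1 : A) (1 : B)) tens_mul.
Proof.
move=> x; elim/tens_ind: x => [|x y xP yP|a b].
- exact: tens_mul0r.
- by rewrite tens_mulDr xP yP.
by rewrite tens_mulE !mul1r.
Qed.

Lemma tens_mul1r : right_id (tens (1 : A) (1 : B)) tens_mul.
Proof.
move=> x; elim/tens_ind: x => [|x y xP yP|a b].
- exact: tens_mul0l.
- by rewrite tens_mulDl xP yP.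
by rewrite tens_mulE !mulr1.
Qed.

Lemma tens_mul_scaler k x y : k *: tens_mul x y = tens_mul x (k *: y).
Proof. by rewrite (linear_funZ (tens_mul_linearr x)). Qed.

HB.instance Definition _ := Lmodule_isPzAlg.Build K (tensor A B)
  tens_mulA tens_mul1l tens_mul1r tens_mulDl tens_mulDr
  tens_mul_scalel tens_mul_scaler.
HB.instance Definition _ := GRing.PzRing.copy (tensor A B) (PzAlg.sort (tensor A B)).

Lemma tensM (a a' : A) (b b' : B) :
  tens a b * tens a' b' = tens (a * a') (b * b').
Proof. exact: tens_mulE. Qed.

End TensorAlgebra.

Definition tens_map (K : fieldType) (V V' W W' : lmodType K)
    (f : V -> V') (g : W -> W') : tensor V W -> tensor V' W' :=
  tens_lift (fun v w => tens (f v) (g w)).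

Definition tens_assoc (K : fieldType) (U V W : lmodType K) :
    tensor U (tensor V W) -> tensor (tensor U V) W :=
  tens_lift (fun u => tens_lift (fun v w => tens (tens u v) w)).

Record hopf_algebra (K : fieldType) := HopfAlgebra {
  hopf_sort :> pzAlgType K;
  comul : alg_hom hopf_sort (tensor hopf_sort hopf_sort);
  counit : hopf_sort -> K;
  antipode : hopf_sort -> hopf_sort;
  counit_linear : scalar counit;
  counit_monoid : monoid_morphism counit;
  antipode_linear : linear antipode;
  comul_coassoc : forall h,
    tens_map comul idfun (comul h) = tens_assoc (tens_map idfun comul (comul h));
  comul_counitl : forall h,
    tens_lift (fun x y : hopf_sort => counit x *: y) (comul h) = h;
  comul_counitr : forall h,
    tens_lift (fun x y : hopf_sort => counit y *: x) (comul h) = h;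
  antipodel : forall h,
    tens_lift (fun x y : hopf_sort => antipode x * y) (comul h) = counit h *: (1 : hopf_sort);
  antipoder : forall h,
    tens_lift (fun x y : hopf_sort => x * antipode y) (comul h) = counit h *: (1 : hopf_sort)
}.

(* [comul_star] says that comul (star h) = (star (x) star) (comul h); it is   *)
(* written on representatives because star is antilinear, and so does not     *)
(* fit [tens_map].                                                            *)
Record hopf_star_algebra (K : numClosedFieldType) := HopfStarAlgebra {
  hopf_star_sort :> hopf_algebra K;
  star : hopf_star_sort -> hopf_star_sort;
  starD : forall x y, star (x + y) = star x + star y;
  starZ : forall (k : K) x, star (k *: x) = Num.conj k *: star x;
  starM : forall x y, star (x * y) = star y * star x;
  starK : involutive star;
  comul_star : forall h (s : seq (hopf_star_sort * hopf_star_sort)),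
    comul hopf_star_sort h = \sum_(p <- s) tens p.1 p.2 ->
    comul hopf_star_sort (star h) = \sum_(p <- s) tens (star p.1) (star p.2)
}.

Section Corepresentations.

Context (K : numClosedFieldType) (H : hopf_star_algebra K).

Definition scalar_mx_in m n (M : 'M[K]_(m, n)) : 'M[H]_(m, n) :=
  map_mx (fun k => k *: (1 : H)) M.

(* The counit condition excludes degenerate solutions of the comultiplication *)
(* condition such as the 1 x 1 matrix 0.                                      *)
Definition unitary_corep n (u : 'M[H]_n) : Prop :=
  [/\ forall i j, comul H (u i j) = \sum_k tens (u i k) (u k j),
      forall i j, counit (u i j) = (i == j)%:R
    & forall i j, star (u i j) = antipode (u j i)].

(* The columns of W are a basis of an m-dimensional subspace of K^n, and      *)
(* u W = W v says that the subspace is invariant under the corepresentation   *)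
(* e_j |-> \sum_k e_k (x) u_kj, which acts on it by the matrix v.             *)
Definition irreducible_corep n (u : 'M[H]_n) : Prop :=
  (0 < n)%N /\
  forall m (W : 'M[K]_(n, m)) (v : 'M[H]_m), \rank W = m ->
    u *m scalar_mx_in W = scalar_mx_in W *m v -> m = 0%N \/ m = n.

Definition equivalent_corep m n (u : 'M[H]_m) (v : 'M[H]_n) : Prop :=
  exists (T : 'M[K]_(m, n)) (T' : 'M[K]_(n, m)),
    [/\ T *m T' = 1%:M, T' *m T = 1%:M
      & u *m scalar_mx_in T = scalar_mx_in T *m v].

End Corepresentations.

(* A compact quantum group G given by the Hopf *-algebra P(G), with an index  *)
(* set for the equivalence classes of irreducible unitary matrix              *)
(* corepresentations, one representative per class, and the Peter-Weyl        *)
(* property that the matrix entries of these form a linear basis of P(G).     *)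
(* This property characterises the Hopf *-algebras that are of the form P(G). *)
Record compact_quantum_group (K : numClosedFieldType) := CompactQuantumGroup {
  cqg_poly : hopf_star_algebra K;
  irr_class : eqType;
  irr_dim : irr_class -> nat;
  irr_rep : forall a, 'M[cqg_poly]_(irr_dim a);
  irr_rep_unitary : forall a, unitary_corep (irr_rep a);
  irr_rep_irreducible : forall a, irreducible_corep (irr_rep a);
  irr_rep_complete : forall n (v : 'M[cqg_poly]_n),
    unitary_corep v -> irreducible_corep v ->
    exists! a, equivalent_corep v (irr_rep a);
  irr_rep_span : forall h : cqg_poly,
    exists (s : seq irr_class) (c : forall a, 'M[K]_(irr_dim a)),
      h = \sum_(a <- s) \sum_k \sum_l c a k l *: irr_rep a k l;
  irr_rep_free : forall (s : seq irr_class) (c : forall a, 'M[K]_(irr_dim a)),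
    uniq s ->
    \sum_(a <- s) \sum_k \sum_l c a k l *: irr_rep a k l = 0 ->
    forall a, a \in s -> c a = 0
}.

Definition complete_covering (K : fieldType) (A : pzAlgType K) (I : finType)
    (J : I -> ideal A) : Prop :=
  (forall x, (forall i, J i x) -> x = 0) /\
  (forall x : forall i, quot (J i),
    (forall i j, quot_map (ideal_sum (J i) (J j)) (x i)
               = quot_map (ideal_sum (J i) (J j)) (x j)) ->
    exists y, forall i, quot_pi (J i) y = x i).

Definition right_coaction (K : fieldType) (A : pzAlgType K) (H : hopf_algebra K) :
    tensor A H -> tensor (tensor A H) H :=
  fun x => tens_assoc (tens_map idfun (comul H) x).

Record qpfb (K : fieldType) (H : hopf_algebra K) := Qpfb {
  base_alg : pzAlgType K;
  patch : finType;
  base_ideal : patch -> ideal base_alg;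
  base_covering : complete_covering base_ideal;
  total_alg : pzAlgType K;
  coaction : alg_hom total_alg (tensor total_alg H);
  coaction_coassoc : forall p,
    tens_map coaction idfun (coaction p)
    = tens_assoc (tens_map idfun (comul H) (coaction p));
  coaction_counit : forall p,
    tens_lift (fun (q : total_alg) (h : H) => counit h *: q) (coaction p) = p;
  embed : alg_hom base_alg total_alg;
  embed_inj : injective embed;
  triv : forall i, alg_hom total_alg (tensor (quot (base_ideal i)) H);
  triv_surj : forall i, surj (triv i);
  triv_embed : forall i b, triv i (embed b) = tens (quot_pi (base_ideal i) b) (1 : H);
  triv_coaction : forall i p,
    tens_map (triv i) idfun (coaction p) = right_coaction (triv i p);
  triv_covering : complete_covering (fun i => ker_ideal (triv i))
}.

Section Gauge.

Context (K : fieldType) (H : hopf_algebra K) (X : qpfb H).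

Local Notation J := (@base_ideal K H X).

Definition patch_alg (i : patch X) : pzAlgType K := quot (J i).
Definition overlap_ideal (i j : patch X) : ideal (base_alg X) := ideal_sum (J i) (J j).
Definition overlap_alg (i j : patch X) : pzAlgType K := quot (overlap_ideal i j).

(* [restr] is B_i -> B_ij and [restr'] is B_j -> B_ij.  The types B_ij and    *)
(* B_ji are quotients by the same ideal but are not convertible, so [flip] is *)
(* the identification of B_ji with B_ij.                                      *)
Definition restr i j (x : patch_alg i) : overlap_alg i j :=
  quot_map (overlap_ideal i j) x.
Definition restr' i j (x : patch_alg j) : overlap_alg i j :=
  quot_map (overlap_ideal i j) x.
Definition flip i j (x : overlap_alg j i) : overlap_alg i j :=
  quot_map (overlap_ideal i j) x.

Arguments restr : clear implicits.
Arguments restr' : clear implicits.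
Arguments flip : clear implicits.

(* [transition_triv] is (restr (x) id) o chi_i = phi_ij o (restr' (x) id) o   *)
(* chi_j with phi_ij (a (x) h) = \sum a tau_ji(h_1) (x) h_2.  Such functions  *)
(* are unique, because the chi_j are onto.                                    *)
Record transition_functions := TransitionFunctions {
  transition :> forall i j, alg_hom H (overlap_alg i j);
  transition_central : forall i j h x,
    transition i j h * x = x * transition i j h;
  transition_antipode : forall i j h,
    flip i j (transition j i h) = transition i j (antipode h);
  transition_triv : forall i j p,
    tens_map (restr i j) idfun (triv i p)
    = tens_lift (fun (a : overlap_alg i j) (h : H) =>
        tens_lift (fun h1 h2 : H => tens (a * flip i j (transition j i h1)) h2)
          (comul H h))
        (tens_map (restr' i j) idfun (triv j p))
}.

Variant side := Left | Right.

Definition side_mul (s : side) (A : pzAlgType K) (a x : A) : A :=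
  if s is Left then a * x else x * a.

Definition local_gauge (s : side) (i : patch X)
    (g : tensor (patch_alg i) H -> tensor (patch_alg i) H) : Prop :=
  [/\ linear g, bijective g,
      forall (a : patch_alg i) x,
        g (side_mul s (tens a (1 : H)) x) = side_mul s (tens a (1 : H)) (g x),
      forall x, tens_map g idfun (right_coaction x) = right_coaction (g x)
    & forall a : patch_alg i, g (tens a (1 : H)) = tens a (1 : H)].

Definition local_form (i : patch X) (f : total_alg X -> total_alg X)
    (g : tensor (patch_alg i) H -> tensor (patch_alg i) H) : Prop :=
  forall p, triv i (f p) = g (triv i p).

Definition gauge (s : side) : set (total_alg X -> total_alg X) :=
  [set f | [/\ linear f, bijective f,
      forall (b : base_alg X) p,
        f (side_mul s (embed X b) p) = side_mul s (embed X b) (f p)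
    & forall i : patch X, exists2 g, local_gauge s g & local_form (i := i) f g]]%classic.

End Gauge.

Arguments restr {K H X} i j x.
Arguments restr' {K H X} i j x.
Arguments flip {K H X} i j x.
Arguments gauge {K H} X s.

Definition mx_invertible (A : pzRingType) n (M : 'M[A]_n) : Prop :=
  exists M', M *m M' = 1%:M /\ M' *m M = 1%:M.

Section GaugeMatrices.

Context (K : numClosedFieldType) (G : compact_quantum_group K).
Context (X : qpfb (cqg_poly G)) (tau : transition_functions X).

Local Notation u := (@irr_rep K G).

Definition mx_family : Type :=
  forall (i : patch X) (a : irr_class G), 'M[patch_alg i]_(irr_dim a).

(* The last condition is the normalisation alpha (a (x) 1) = a (x) 1 of gauge *)
(* transformations: it concerns only the class of the trivial                 *)
(* corepresentation, whose representative is the 1 x 1 identity matrix.       *)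
Definition gauge_matrices : set mx_family :=
  [set b | [/\ forall i a, mx_invertible (b i a),
      forall i j a k l,
        restr i j (b i a k l)
        = \sum_m \sum_n tau i j (u a k m) * restr' i j (b j a m n)
                         * flip i j (tau j i (u a n l))
    & forall i a, u a = 1%:M -> b i a = 1%:M]]%classic.

(* On the right the entries are taken at S(u_kl): a |-> \sum_k b_km a_k is    *)
(* bijective when the transpose of b is invertible, which for                 *)
(* noncommutative B_i is not equivalent to the invertibility of b.            *)
Definition local_matrix (s : side) (i : patch X)
    (g : tensor (patch_alg i) (cqg_poly G) -> tensor (patch_alg i) (cqg_poly G))
    (b : forall a, 'M[patch_alg i]_(irr_dim a)) : Prop :=
  forall a k l,
    match s with
    | Left => g (tens (1 : patch_alg i) (u a k l)) = \sum_m tens (b a k m) (u a m l)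
    | Right => g (tens (1 : patch_alg i) (antipode (u a k l)))
               = \sum_m tens (b a m l) (antipode (u a k m))
    end.

End GaugeMatrices.

(* Main.v *)
From HB Require Import structures.
From mathcomp Require Import all_boot all_order all_algebra.
From mathcomp Require Import boolp classical_sets functions reals complex.
Require Import Defs.

(* A gauge transformation g of A (x) H is determined by the g(1 (x) e_kl),     *)
(* where e runs over matrix corepresentations whose entries form a basis of H. *)
(* By colinearity g(1 (x) e_kl) = \sum_m c_km (x) e_ml, with c_km the image of  *)
(* g(1 (x) e_km) under id (x) counit, and g is bijective exactly when the      *)
(* matrices c are invertible.  Left transformations use e = u; right ones use  *)
(* e_kl = S(u_lk) = (u_kl)^*, and the entries of these also form a basis,      *)
(* because the star is an antilinear involution.                               *)
(* The transition map of an overlap is given by matrices too, so compatibility *)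
(* of the local transformations is a matrix identity: conjugation by           *)
(* tau_ij(u), whose inverse is tau_ij(S(u)).  Compatible local transformations *)
(* glue by completeness of the covering (ker chi_i), because the kernel of     *)
(* (restr (x) id) o chi_i is ker chi_i + ker chi_j.                            *)

Set Implicit Arguments.
Unset Strict Implicit.
Unset Printing Implicit Defensive.

Import Order.TTheory GRing.Theory Num.Theory.

Local Open Scope ring_scope.

(** A linear map of A (x) H that commutes with the multiplications by A from one side and with the
    coaction is the same thing as a family of matrices. [colinear_has_matrix] extracts the matrices,
    [has_matrix_exists] realises any family, and [has_matrix_inj] and [has_matrix_funext] say that
    map and family determine each other. Composition becomes matrix multiplication
    ([has_matrix_comp]), so bijectivity becomes invertibility, and fixing a (x) 1 only constrains
    the class of the trivial corepresentation. This is [local_gaugeP].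

    The transition map of an overlap has matrices as well, built from the transition functions. Two
    local transformations therefore agree on the overlap exactly when their restricted matrices
    intertwine these, which rearranges to the conjugation formula [glued] ([compatibleP]).

    The chi_i are jointly injective, so a global map is determined by its local forms; conversely
    [gluing] assembles compatible local forms. Gluing the inverse matrices too gives the inverse of
    the global map. *)

(** * Linear bases indexed by classes and matrix positions *)

Section Basis.

Context (K : fieldType) (C : eqType) (d : C -> nat).

Definition comb (V : lmodType K) (e : forall a, 'I_(d a) -> 'I_(d a) -> V)
    (s : seq C) (c : forall a, 'M[K]_(d a)) : V :=
  \sum_(a <- s) \sum_k \sum_l c a k l *: e a k l.

Lemma comb_linear (V : lmodType K) (e : forall a, 'I_(d a) -> 'I_(d a) -> V)
    s k (c c' : forall a, 'M[K]_(d a)) :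
  comb e s (fun a => k *: c a + c' a) = k *: comb e s c + comb e s c'.
Proof.
rewrite /comb scaler_sumr -big_split; apply: eq_bigr => a _ /=.
rewrite scaler_sumr -big_split; apply: eq_bigr => i _ /=.
rewrite scaler_sumr -big_split; apply: eq_bigr => j _ /=.
by rewrite !mxE scalerDl scalerA.
Qed.

(** A spanning list may repeat a class; merging the repetitions multiplies its coefficients by the
    multiplicity. *)
Lemma comb_undup (V : lmodType K) (e : forall a, 'I_(d a) -> 'I_(d a) -> V) s c :
  comb e (undup s) (fun a => c a *+ count_mem a s) = comb e s c.
Proof.
rewrite /comb -[RHS]big_undup_iterop_count; apply: eq_bigr => a _.
rewrite -[RHS]/(_ *+ _) -sumrMnl; apply: eq_bigr => k _.
by rewrite -sumrMnl; apply: eq_bigr => l _; rewrite mulmxnE scalerMnl.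
Qed.

Lemma comb_sub (V : lmodType K) (e : forall a, 'I_(d a) -> 'I_(d a) -> V) s t c :
  uniq s -> uniq t -> {subset s <= t} -> (forall a, a \notin s -> c a = 0) ->
  comb e t c = comb e s c.
Proof.
move=> us ut st c0; rewrite /comb (bigID (mem s)) /= [X in _ + X]big1 ?addr0.
  rewrite -big_filter; apply: perm_big; apply: uniq_perm; rewrite ?filter_uniq//.
  by move=> a; rewrite mem_filter andb_idr//; exact: st.
by move=> a /c0 ->; do 2![apply: big1 => ? _]; rewrite mxE scale0r.
Qed.

Definition basis (V : lmodType K) (e : forall a, 'I_(d a) -> 'I_(d a) -> V) :=
  (forall x, exists s c, x = comb e s c) /\
  (forall s c, uniq s -> comb e s c = 0 -> forall a, a \in s -> c a = 0).

(** The expansion of a vector is not canonical, since its support list can be enlarged or permuted.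
    One expansion is chosen for each vector, and freeness shows that every other one yields the same
    image. *)
Lemma basis_ext (V U : lmodType K) (e : forall a, 'I_(d a) -> 'I_(d a) -> V)
    (y : forall a, 'I_(d a) -> 'I_(d a) -> U) : basis e ->
  exists2 L : V -> U, linear L & forall a k l, L (e a k l) = y a k l.
Proof.
move=> [espan efree].
have coords x : exists sc : seq C * (forall a, 'M[K]_(d a)),
    [/\ uniq sc.1, forall a, a \notin sc.1 -> sc.2 a = 0 & x = comb e sc.1 sc.2].
  have [s [c ->]] := espan x.
  exists (undup s, fun a => c a *+ count_mem a s); split=> /=.
  - exact: undup_uniq.
  - by move=> a; rewrite mem_undup => /count_memPn ->.
  - by rewrite comb_undup.
have [S SP] := choice coords.
have LE (W : lmodType K) (z : forall a, 'I_(d a) -> 'I_(d a) -> W) x t :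
    uniq t -> {subset (S x).1 <= t} ->
    comb z (S x).1 (S x).2 = comb z t (S x).2.
  by have [us c0 _] := SP x => ut st; exact/esym/comb_sub.
(* Both expansions are extended by zero to a common duplicate-free list, where freeness equates
   their coefficients. *)
have Luniq x t c : uniq t -> (forall a, a \notin t -> c a = 0) ->
    x = comb e t c -> comb y (S x).1 (S x).2 = comb y t c.
  move=> ut c0 xE; pose r := undup ((S x).1 ++ t).
  have ur : uniq r by exact: undup_uniq.
  have Sr : {subset (S x).1 <= r}.
    by move=> a; rewrite mem_undup mem_cat => ->.
  have tr : {subset t <= r} by move=> a; rewrite mem_undup mem_cat orbC => ->.
  rewrite (LE _ _ _ r)// -(comb_sub (t := r) y ut)//.
  have xr : x = comb e r (S x).2 by rewrite -LE//; have [] := SP x.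
  have : comb e r (fun a => (-1) *: c a + (S x).2 a) = 0.
    by rewrite comb_linear -xr (comb_sub e ut)// -xE scaleN1r addNr.
  move=> /(efree _ _ ur) cS; rewrite /comb; apply: eq_big_seq => a /cS.
  by rewrite scaleN1r addrC => /subr0_eq ->.
exists (fun x => comb y (S x).1 (S x).2) => [k x x'|a k l].
- pose t := undup ((S x).1 ++ (S x').1).
  have ut : uniq t by exact: undup_uniq.
  have xt : {subset (S x).1 <= t} by move=> a; rewrite mem_undup mem_cat => ->.
  have x't : {subset (S x').1 <= t}.
    by move=> a; rewrite mem_undup mem_cat orbC => ->.
  rewrite (Luniq _ t (fun a => k *: (S x).2 a + (S x').2 a))//.
  + by rewrite comb_linear -!LE.
  + move=> a; rewrite mem_undup mem_cat negb_or => /andP[/= ax ax'].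
    have [_ Sx _] := SP x; have [_ Sx' _] := SP x'.
    by rewrite Sx// Sx'// scaler0 addr0.
  + by rewrite comb_linear -!LE//; have [_ _ <-] := SP x; have [_ _ <-] := SP x'.
(* The elementary matrix at (k, l) in class [a]; indices are compared as naturals because [b] and
   [a] give different ordinal types. *)
- pose c b : 'M[K]_(d b) :=
    \matrix_(i, j) ([&& b == a, i == k :> nat & j == l :> nat])%:R.
  have combc (W : lmodType K) (z : forall a, 'I_(d a) -> 'I_(d a) -> W) :
      comb z [:: a] c = z a k l.
    rewrite /comb big_seq1 (bigD1 k)//= (bigD1 l)//= !mxE !eqxx scale1r.
    rewrite !big1 ?addr0// => [i /negbTE ik|j /negbTE jl].
      apply: big1 => j _; rewrite !mxE -val_eqE/= in ik *.
      by rewrite ik andbF scale0r.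
    by rewrite !mxE -val_eqE/= in jl *; rewrite jl !andbF scale0r.
  rewrite (Luniq _ [:: a] c)// => b; rewrite inE => /negbTE ba.
  by apply/matrixP => i j; rewrite !mxE ba.
Qed.

Lemma basis_eq (V U : lmodType K) (e : forall a, 'I_(d a) -> 'I_(d a) -> V)
    (f g : V -> U) : basis e -> linear f -> linear g ->
  (forall a k l, f (e a k l) = g (e a k l)) -> f =1 g.
Proof.
move=> [espan _] flin glin fg x; have [s [c ->]] := espan x.
have lin0 (h : V -> U) : linear h -> h 0 = 0 by exact: linear_fun0.
pose Q x := f x = g x.
have Q0 : Q 0 by rewrite /Q !lin0.
have QD x1 x2 : Q x1 -> Q x2 -> Q (x1 + x2).
  by rewrite /Q !(linear_funD flin, linear_funD glin) => -> ->.
rewrite -/(Q _); do 3![apply: big_ind => // ? _].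
by rewrite /Q (linear_funZ flin) (linear_funZ glin) fg.
Qed.

End Basis.

(** * Linear maps on tensor products *)

Lemma comp_linear (K : fieldType) (U V W : lmodType K) (f : V -> W) (g : U -> V) :
  linear f -> linear g -> linear (f \o g).
Proof. by move=> flin glin k x y /=; rewrite glin flin. Qed.

Lemma linear_fun_sum (K : fieldType) (U V : lmodType K) (f : U -> V) (I : Type)
    (r : seq I) (F : I -> U) :
  linear f -> f (\sum_(i <- r) F i) = \sum_(i <- r) f (F i).
Proof.
by move=> flin; apply: (big_morph f (linear_funD flin) (linear_fun0 flin)).
Qed.

Section TensorMaps.

Context (K : fieldType).

Lemma tens_suml (V W : lmodType K) (I : Type) (r : seq I) (F : I -> V) (w : W) :
  tens (\sum_(i <- r) F i) w = \sum_(i <- r) tens (F i) w.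
Proof. exact: linear_fun_sum (tens_linearl w). Qed.

Lemma tens_map_bilinear (V V' W W' : lmodType K) (f : V -> V') (g : W -> W') :
  linear f -> linear g -> bilinear_map (fun v w => tens (f v) (g w)).
Proof.
move=> flin glin; split=> [w|v] k x y /=.
- by rewrite flin tens_linearl.
- by rewrite glin tens_linearr.
Qed.

Lemma tens_map_linear (V V' W W' : lmodType K) (f : V -> V') (g : W -> W') :
  linear f -> linear g -> linear (tens_map f g).
Proof. by move=> ? ?; exact/tens_lift_linear/tens_map_bilinear. Qed.

Lemma tens_mapE (V V' W W' : lmodType K) (f : V -> V') (g : W -> W') v w :
  linear f -> linear g -> tens_map f g (tens v w) = tens (f v) (g w).
Proof. by move=> ? ?; exact/tens_liftE/tens_map_bilinear. Qed.

Lemma idfun_linear (V : lmodType K) : linear (@idfun V).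
Proof. by []. Qed.

Lemma tens_map_idr_linear (V V' W : lmodType K) (f : V -> V') :
  linear f -> linear (tens_map f (@idfun W)).
Proof. by move=> flin; apply: tens_map_linear => //; exact: idfun_linear. Qed.

Lemma tens_map_surj (V V' W : lmodType K) (f : V -> V') :
  linear f -> surj f -> surj (tens_map f (@idfun W)).
Proof.
move=> flin fsurj; have mlin := tens_map_idr_linear (W := W) flin.
elim/tens_ind=> [|_ _ [x <-] [y <-]|v' w].
- by exists 0; exact: linear_fun0 mlin.
- by exists (x + y); rewrite (linear_funD mlin).
- by have [v <-] := fsurj v'; exists (tens v w); rewrite tens_mapE.
Qed.

Lemma tens_assoc_bilinear1 (U V W : lmodType K) (u : U) :
  bilinear_map (fun (v : V) (w : W) => tens (tens u v) w).
Proof.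
split=> [w|v] k x y /=; last by rewrite tens_linearr.
by rewrite tens_linearr tens_linearl.
Qed.

Lemma tens_assoc_bilinear2 (U V W : lmodType K) : bilinear_map
  (fun u : U => tens_lift (fun (v : V) (w : W) => tens (tens u v) w)).
Proof.
split=> [z|u]; last exact/tens_lift_linear/tens_assoc_bilinear1.
move=> k x y; rewrite /tens_lift scaler_sumr -big_split /=.
by apply: eq_bigr => -[v w] _ /=; rewrite !tens_linearl.
Qed.

Lemma tens_assoc_linear (U V W : lmodType K) : linear (@tens_assoc K U V W).
Proof. exact/tens_lift_linear/tens_assoc_bilinear2. Qed.

Lemma tens_assocE (U V W : lmodType K) (u : U) (v : V) (w : W) :
  tens_assoc (tens u (tens v w)) = tens (tens u v) w.
Proof.
rewrite /tens_assoc tens_liftE; last exact: tens_assoc_bilinear2.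
by rewrite tens_liftE//; exact: tens_assoc_bilinear1.
Qed.

Lemma right_coaction_linear (A : pzAlgType K) (H : hopf_algebra K) :
  linear (@right_coaction K A H).
Proof.
apply: (@comp_linear _ _ _ _ _ (tens_map idfun (comul H))).
  exact: tens_assoc_linear.
by apply: tens_map_linear; [exact: idfun_linear|exact: alg_hom_linear].
Qed.

End TensorMaps.

(** * Uniform treatment of the left and right cases *)

Section SideMul.

Context (K : fieldType) (s : side) (A : pzAlgType K).

Lemma side_mulA (x y z : A) :
  side_mul s (side_mul s x y) z = side_mul s x (side_mul s y z).
Proof. by case: s; rewrite /= mulrA. Qed.

Lemma side_mul1l (x : A) : side_mul s 1 x = x.
Proof. by case: s; rewrite /= ?mul1r ?mulr1. Qed.

Lemma side_mulr1 (x : A) : side_mul s x 1 = x.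
Proof. by case: s; rewrite /= ?mul1r ?mulr1. Qed.

Lemma side_mul_linearl (y : A) : linear (fun x : A => side_mul s x y).
Proof.
case: s => k x x' /=; first by rewrite mulrDl alg_scalerAl.
by rewrite mulrDr alg_scalerAr.
Qed.

Lemma side_mul_linearr (x : A) : linear (side_mul s x).
Proof.
case: s => k y y' /=; first by rewrite mulrDr alg_scalerAr.
by rewrite mulrDl alg_scalerAl.
Qed.

Lemma side_mul_central (x y : A) : (forall z, y * z = z * y) ->
  side_mul s x y = x * y.
Proof. by case: s => //= ->. Qed.

Lemma alg_hom_side_mul (B : pzAlgType K) (f : alg_hom A B) x y :
  f (side_mul s x y) = side_mul s (f x) (f y).
Proof. by case: s; rewrite /= rmorphM. Qed.

Lemma side_mul_tens (B : pzAlgType K) (x x' : A) (y : B) :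
  side_mul s (tens x (1 : B)) (tens x' y) = tens (side_mul s x x') y.
Proof. by case: s; rewrite /= tensM ?mul1r ?mulr1. Qed.

End SideMul.

(** Over a noncommutative algebra, multiplying entries in the opposite order amounts to transposing
    and swapping the matrix factors. [side_tr] and [side_mulmx] absorb this, so that one proof
    serves both sides. *)
Definition side_tr (s : side) (R : Type) n (M : 'M[R]_n) : 'M[R]_n :=
  if s is Left then M else M^T.

Definition side_mulmx (s : side) (R : pzRingType) n (M N : 'M[R]_n) : 'M[R]_n :=
  if s is Left then M *m N else N *m M.

Lemma side_trK (s : side) (R : Type) n : involutive (@side_tr s R n).
Proof. by case: s => // M; exact: trmxK. Qed.

Lemma side_tr1 (s : side) (R : pzRingType) n : side_tr s (1%:M : 'M[R]_n) = 1%:M.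
Proof. by case: s => //; exact: trmx1. Qed.

Lemma side_mulmxE (s : side) (K : fieldType) (A : pzAlgType K) n
    (M N : 'M[A]_n) i j :
  side_tr s (side_mulmx s M N) i j
  = \sum_k side_mul s (side_tr s M i k) (side_tr s N k j).
Proof.
case: s => /=; first exact: mxE.
by rewrite 2!mxE; apply: eq_bigr => k _; rewrite !mxE.
Qed.

(** * Colinear maps as families of matrices *)

Section ComatrixBasis.

Context (K : fieldType) (H : hopf_algebra K) (C : eqType) (d : C -> nat).
Context (e : forall a, 'I_(d a) -> 'I_(d a) -> H) (s : side).

Definition comatrix_basis : Prop := basis e /\
  forall a k l, comul H (e k l) = \sum_m tens (e (a := a) k m) (e m l).

(** The matrix acts on the first index of [e] only: the right coaction moves the second one, and [g]
    has to commute with it. *)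
Definition has_matrix (A : pzAlgType K) (g : tensor A H -> tensor A H)
    (b : forall a, 'M[A]_(d a)) : Prop :=
  linear g /\ forall x a k l, g (tens x (e (a := a) k l))
    = \sum_m tens (side_mul s x (side_tr s (b a) k m)) (e m l).

Context (eP : comatrix_basis).

Let ebasis := eP.1.
Let ecomul := eP.2.

Lemma tensor_basis_eq (V U : lmodType K) (f g : tensor V H -> U) :
  linear f -> linear g ->
  (forall v a k l, f (tens v (e (a := a) k l)) = g (tens v (e k l))) -> f =1 g.
Proof.
move=> flin glin fg; apply: tens_ext => // v.
apply: (basis_eq ebasis (f := f \o tens v) (g := g \o tens v)) => [||a k l].
- exact/comp_linear/tens_linearr.
- exact/comp_linear/tens_linearr.
- exact: fg.
Qed.

(** The functional dual to the basis element [e l l], applied to the second tensor factor, reads off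
    the entry at (k, l). *)
Lemma tensor_comatrix_free (V : lmodType K) a (x y : 'M[V]_(d a)) :
  (forall k l, \sum_m tens (x k m) (e m l) = \sum_m tens (y k m) (e m l)) ->
  x = y.
Proof.
move=> xy; apply/matrixP => k l.
have [L Llin LE] := basis_ext (U := K^o) (fun b (i j : 'I_(d b)) =>
  ([&& b == a, i == l :> nat & j == l :> nat])%:R) ebasis.
have cbil : bilinear_map (fun (v : V) (h : H) => L h *: v).
  split=> [h|v] c v1 v2 /=; first by rewrite scalerDr !scalerA mulrC.
  by rewrite Llin scalerDl scalerA.
have coord (z : 'M[V]_(d a)) :
    tens_lift (fun v h => L h *: v) (\sum_m tens (z k m) (e m l)) = z k l.
  rewrite linear_fun_sum; last exact: tens_lift_linear.
  rewrite (bigD1 l)//= tens_liftE// LE !eqxx scale1r big1 ?addr0// => m.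
  by rewrite tens_liftE// LE -val_eqE/= => /negbTE ->; rewrite andbF scale0r.
by rewrite -coord xy coord.
Qed.

Section LocalAlgebra.

Context (A : pzAlgType K).
Implicit Types (g : tensor A H -> tensor A H) (b : forall a, 'M[A]_(d a)).

Lemma has_matrix_exists b : exists g, has_matrix g b.
Proof.
have [L Llin LE] := basis_ext (U := tensor A H)
  (fun a k l => \sum_m tens (side_tr s (b a) k m) (e m l)) ebasis.
have gbil : bilinear_map (fun (x : A) (h : H) =>
    side_mul s (tens x (1 : H)) (L h)).
  split=> [h|x] k y z /=.
  - by rewrite tens_linearl side_mul_linearl.
  - by rewrite Llin side_mul_linearr.
exists (tens_lift (fun (x : A) (h : H) => side_mul s (tens x (1 : H)) (L h))).
split=> [|x a k l]; first exact: tens_lift_linear.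
rewrite tens_liftE// LE (linear_fun_sum _ _ (side_mul_linearr s _)).
by apply: eq_bigr => m _; exact: side_mul_tens.
Qed.

Lemma has_matrix_funext g g' b : has_matrix g b -> has_matrix g' b -> g =1 g'.
Proof.
move=> [glin gE] [g'lin g'E]; apply: tensor_basis_eq => // x a k l.
by rewrite gE g'E.
Qed.

Lemma has_matrix_inj g b b' :
  has_matrix g b -> has_matrix g b' -> forall a, b a = b' a.
Proof.
move=> [_ gE] [_ gE'] a; rewrite -[b a](side_trK s) -[b' a](side_trK s).
congr side_tr.
apply: tensor_comatrix_free => k l.
have := gE 1 a k l; rewrite gE'.
under [LHS]eq_bigr do rewrite side_mul1l.
by under [in RHS]eq_bigr do rewrite side_mul1l.
Qed.

(** The order is reversed because [g] passes the coefficients produced by [g'] and acts on the basis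
    elements behind them. *)
Lemma has_matrix_comp g g' b b' : has_matrix g b -> has_matrix g' b' ->
  has_matrix (g \o g') (fun a => side_mulmx s (b' a) (b a)).
Proof.
move=> [glin gE] [g'lin g'E]; split=> [|x a k l /=]; first exact: comp_linear.
rewrite g'E (linear_fun_sum _ _ glin); under [LHS]eq_bigr do rewrite gE.
rewrite exchange_big; apply: eq_bigr => m _ /=.
rewrite side_mulmxE (linear_fun_sum _ _ (side_mul_linearr s x)).
by rewrite tens_suml; apply: eq_bigr => n _; rewrite side_mulA.
Qed.

Lemma has_matrix_id : has_matrix (A := A) id (fun a => 1%:M).
Proof.
split=> // x a k l; rewrite side_tr1 (bigD1 k)//= big1 ?addr0 => [|m mk].
  by rewrite mxE eqxx side_mulr1.
rewrite mxE eq_sym (negbTE mk) (linear_fun0 (side_mul_linearr s x)).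
exact: linear_fun0 (tens_linearl _).
Qed.

Lemma has_matrix_cancel g g' b b' : has_matrix g b -> has_matrix g' b' ->
  (forall a, side_mulmx s (b a) (b' a) = 1%:M) -> cancel g g'.
Proof.
move=> gb g'b' bb'; have := has_matrix_comp g'b' gb.
rewrite (_ : (fun a => _) = fun a => 1%:M).
  by move=> gg'; exact: has_matrix_funext gg' has_matrix_id.
exact: functional_extensionality_dep.
Qed.

Lemma has_matrix_linear_side g b : has_matrix g b -> forall (x : A) z,
  g (side_mul s (tens x (1 : H)) z) = side_mul s (tens x (1 : H)) (g z).
Proof.
move=> [glin gE] x.
apply: (tensor_basis_eq (f := g \o side_mul s (tens x (1 : H)))
  (g := side_mul s (tens x (1 : H)) \o g)).
- exact/comp_linear/side_mul_linearr.
- by apply: comp_linear => //; exact: side_mul_linearr.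
move=> y a k l /=; rewrite side_mul_tens !gE.
rewrite (linear_fun_sum _ _ (side_mul_linearr s _)).
by apply: eq_bigr => m _; rewrite side_mul_tens side_mulA.
Qed.

Lemma right_coactionE (x : A) a k l :
  right_coaction (tens x (e (a := a) k l)) = \sum_m tens (tens x (e k m)) (e m l).
Proof.
rewrite /right_coaction tens_mapE; last 2 first.
- exact: idfun_linear.
- exact: alg_hom_linear.
rewrite ecomul (linear_fun_sum _ _ (tens_linearr _)).
rewrite (linear_fun_sum _ _ (@tens_assoc_linear _ _ _ _)).
by apply: eq_bigr => m _; rewrite tens_assocE.
Qed.

(** The coaction splits [e k l] along an inner index, while [g] acts on the outer index [k]; the two
    sums commute. *)
Lemma has_matrix_colinear g b : has_matrix g b -> forall z,
  tens_map g idfun (right_coaction z) = right_coaction (g z).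
Proof.
move=> [glin gE].
have mlin : linear (tens_map g (@idfun H)).
  exact: tens_map_idr_linear.
apply: (tensor_basis_eq (f := tens_map g idfun \o @right_coaction K A H)
  (g := @right_coaction K A H \o g)).
- by apply: comp_linear => //; exact: right_coaction_linear.
- by apply: comp_linear => //; exact: right_coaction_linear.
move=> x a k l /=.
rewrite right_coactionE gE (linear_fun_sum _ _ mlin).
rewrite (linear_fun_sum _ _ (@right_coaction_linear _ A H)).
under [LHS]eq_bigr do rewrite tens_mapE// gE tens_suml.
by rewrite exchange_big; apply: eq_bigr => m _; rewrite right_coactionE.
Qed.

Lemma counit_bilinear : bilinear_map (fun (x : A) (h : H) => counit h *: x).
Proof.
split=> [h|x] k y z /=; first by rewrite scalerDr !scalerA mulrC.
by rewrite counit_linear scalerDl scalerA.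
Qed.

(* Apply (id (x) counit) (x) id to the colinearity equation at 1 (x) e_kl. *)
Lemma colinear_has_matrix g : linear g ->
  (forall (x : A) z,
    g (side_mul s (tens x (1 : H)) z) = side_mul s (tens x (1 : H)) (g z)) ->
  (forall z, tens_map g idfun (right_coaction z) = right_coaction (g z)) ->
  has_matrix g (fun a => side_tr s (\matrix_(k, l)
    tens_lift (fun (x : A) (h : H) => counit h *: x)
      (g (tens (1 : A) (e (a := a) k l))))).
Proof.
move=> glin gside gcol; set E := tens_lift _.
have Elin : linear E by exact/tens_lift_linear/counit_bilinear.
have EE z : tens_map E (@idfun H) (right_coaction z) = z.
  have mlin : linear (tens_map E (@idfun H)).
    exact: tens_map_idr_linear.
  apply: (tens_ext (f := tens_map E idfun \o @right_coaction K A H)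
    (g := id)) => //.
    by apply: comp_linear => //; exact: right_coaction_linear.
  move=> x h /=; rewrite /right_coaction tens_mapE; last 2 first.
  - exact: idfun_linear.
  - exact: alg_hom_linear.
  rewrite -[in RHS](comul_counitl h) /=; move: (comul H h).
  have cbil : bilinear_map (fun y z : H => counit y *: z).
    split=> [w|w] k y' z' /=; last by rewrite scalerDr !scalerA mulrC.
    by rewrite counit_linear scalerDl scalerA.
  apply: (tens_ext (f := tens_map E idfun \o (@tens_assoc K A H H \o tens x))
    (g := tens x \o tens_lift (fun y z : H => counit y *: z))).
  - apply: comp_linear => //; apply: comp_linear; first exact: tens_assoc_linear.
    exact: tens_linearr.
  - apply: comp_linear; first exact: tens_linearr.
    exact: tens_lift_linear.
  move=> y w /=; rewrite tens_assocE tens_mapE//.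
  rewrite /E !tens_liftE//; last exact: counit_bilinear.
  by rewrite (linear_funZ (tens_linearl w)) (linear_funZ (tens_linearr x)).
split=> // x a k l; rewrite side_trK.
have -> : tens x (e k l)
    = side_mul s (tens x (1 : H)) (tens (1 : A) (e (a := a) k l)).
  by rewrite side_mul_tens side_mulr1.
rewrite gside -[g (tens (1 : A) _)]EE -gcol right_coactionE.
have mlin : linear (tens_map g (@idfun H)) by exact: tens_map_idr_linear.
have Emlin : linear (tens_map E (@idfun H)).
  exact: tens_map_idr_linear.
rewrite (linear_fun_sum _ _ mlin) (linear_fun_sum _ _ Emlin).
rewrite (linear_fun_sum _ _ (side_mul_linearr s _)).
by apply: eq_bigr => m _; rewrite !tens_mapE//= mxE side_mul_tens.
Qed.

End LocalAlgebra.

(** Used to carry local transformations to the overlaps. *)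
Lemma has_matrix_alg_hom (A B : pzAlgType K) (f : alg_hom A B)
    (g : tensor A H -> tensor A H) (g' : tensor B H -> tensor B H)
    (b : forall a, 'M[A]_(d a)) :
  has_matrix g b -> has_matrix g' (fun a => map_mx f (b a)) ->
  forall z, tens_map f idfun (g z) = g' (tens_map f idfun z).
Proof.
move=> [glin gE] [g'lin g'E].
have flin := alg_hom_linear f.
have mlin : linear (tens_map f (@idfun H)).
  exact: tens_map_idr_linear.
apply: (tensor_basis_eq (f := tens_map f idfun \o g)
  (g := g' \o tens_map f idfun)).
- exact: comp_linear.
- exact: comp_linear.
move=> x a k l /=; rewrite tens_mapE// gE g'E (linear_fun_sum _ _ mlin).
apply: eq_bigr => m _; rewrite tens_mapE// alg_hom_side_mul /=.
by congr (tens (side_mul s _ _) _); case: s; rewrite /= !mxE.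
Qed.

End ComatrixBasis.

(** * Star, antipode and corepresentations of the quantum group *)

Section StarTheory.

Context (K : numClosedFieldType) (H : hopf_star_algebra K).

Lemma star0 : star (0 : H) = 0.
Proof. by apply: (addrI (star (0 : H))); rewrite -starD !addr0. Qed.

Lemma star1 : star (1 : H) = 1.
Proof. by rewrite -[LHS]mulr1 -{2}[1](starK (1 : H)) -starM mulr1 starK. Qed.

Lemma star_sum (I : Type) (r : seq I) (F : I -> H) :
  star (\sum_(i <- r) F i) = \sum_(i <- r) star (F i).
Proof. exact: (big_morph _ (@starD K H) star0). Qed.

End StarTheory.

Section HopfTheory.

Context (K : fieldType) (H : hopf_algebra K).

Lemma mul_linear_bilinear (f g : H -> H) : linear f -> linear g ->
  bilinear_map (fun x y : H => f x * g y).
Proof.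
move=> flin glin; split=> [y|x] k z w /=.
  by rewrite flin mulrDl alg_scalerAl.
by rewrite glin mulrDr alg_scalerAr.
Qed.

Lemma antipodel_sum (I : finType) (F1 F2 : I -> H) (h : H) :
  comul H h = \sum_i tens (F1 i) (F2 i) ->
  \sum_i antipode (F1 i) * F2 i = counit h *: (1 : H).
Proof.
move=> hE.
have bil := mul_linear_bilinear (@antipode_linear _ H) (@idfun_linear _ H).
rewrite -antipodel hE (linear_fun_sum _ _ (tens_lift_linear bil)).
by apply: eq_bigr => i _; rewrite (tens_liftE _ _ bil).
Qed.

Lemma antipoder_sum (I : finType) (F1 F2 : I -> H) (h : H) :
  comul H h = \sum_i tens (F1 i) (F2 i) ->
  \sum_i F1 i * antipode (F2 i) = counit h *: (1 : H).
Proof.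
move=> hE.
have bil := mul_linear_bilinear (@idfun_linear _ H) (@antipode_linear _ H).
rewrite -antipoder hE (linear_fun_sum _ _ (tens_lift_linear bil)).
by apply: eq_bigr => i _; rewrite (tens_liftE _ _ bil).
Qed.

Lemma antipode1 : antipode (1 : H) = 1.
Proof.
have := @antipodel_sum 'I_1 (fun=> 1) (fun=> 1) 1.
rewrite !big_ord1 mulr1 rmorph1; have [-> _] := counit_monoid H.
by rewrite scale1r; exact.
Qed.

End HopfTheory.

Section CompactQuantumGroup.

Context (K : numClosedFieldType) (G : compact_quantum_group K).

Local Notation H := (cqg_poly G).
Local Notation u := (@irr_rep K G).

(** On the right this is the conjugate corepresentation; the transposition undoes the reversal of
    the comultiplication by the antipode. *)
Definition side_coeff (s : side) a (k l : 'I_(irr_dim a)) : H :=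
  if s is Left then u a k l else antipode (u a l k).

Lemma side_coeff_star a (k l : 'I_(irr_dim a)) :
  side_coeff Right k l = star (u a k l).
Proof. by have [_ _ ->] := irr_rep_unitary a. Qed.

Lemma side_coeff1 s a (k l : 'I_(irr_dim a)) : u a = 1%:M ->
  side_coeff s k l = (k == l)%:R *: (1 : H).
Proof.
move=> ua1; have klE : (k == l)%:R *: (1 : H) = u a k l.
  by rewrite ua1 mxE; case: (k == l); rewrite ?scale1r ?scale0r.
case: s; first by rewrite klE.
by rewrite side_coeff_star -klE starZ star1 conjC_nat.
Qed.

Lemma star_comb t (c : forall a, 'M[K]_(irr_dim a)) :
  star (comb (fun a => u a) t c)
  = comb (side_coeff Right) t (fun a => map_mx Num.conj (c a)).
Proof.
rewrite star_sum; apply: eq_bigr => a _.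
rewrite star_sum; apply: eq_bigr => k _.
rewrite star_sum; apply: eq_bigr => l _.
by rewrite starZ mxE side_coeff_star.
Qed.

Lemma side_coeff_comatrix_basis s : comatrix_basis (side_coeff s).
Proof.
case: s.
  split; last by move=> a k l; have [-> _ _] := irr_rep_unitary a.
  by split; [exact: irr_rep_span|exact: irr_rep_free].
split; last first.
  move=> a k l; rewrite side_coeff_star.
  have [uD _ _] := irr_rep_unitary a.
  rewrite (comul_star (s := [seq (u a k m, u a m l) | m <- enum 'I_(irr_dim a)])).
    by rewrite big_map big_enum; apply: eq_bigr => m _; rewrite !side_coeff_star.
  by rewrite big_map big_enum uD.
split=> [x|t c ut c0 a at_].
  have [t [c xE]] := irr_rep_span (star x).
  exists t, (fun a => map_mx Num.conj (c a)).
  by rewrite -star_comb /comb -xE starK.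
(* Star turns a relation among the starred entries into one among the entries of [u], with conjugate
   coefficients. *)
pose c' a := map_mx Num.conj (c a).
have cE : c = fun a => map_mx Num.conj (c' a).
  apply/functional_extensionality_dep => b; apply/matrixP => i j.
  by rewrite !mxE conjCK.
have : comb (fun a => u a) t c' = 0.
  by rewrite -[LHS]starK star_comb -cE c0 star0.
move=> /(irr_rep_free ut) /(_ a at_) c'0.
by apply/matrixP => i j; move/matrixP: c'0 => /(_ i j); rewrite !mxE => /eqP;
   rewrite conjC_eq0 => /eqP.
Qed.

Lemma scalar_mx_inM m n p (M : 'M[K]_(m, n)) (N : 'M[K]_(n, p)) :
  scalar_mx_in H (M *m N) = scalar_mx_in H M *m scalar_mx_in H N.
Proof.
apply/matrixP => i j; rewrite !mxE scaler_suml; apply: eq_bigr => k _.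
by rewrite !mxE -alg_scalerAl mul1r scalerA.
Qed.

Lemma scalar_mx_in1 n : scalar_mx_in H (1%:M : 'M[K]_n) = 1%:M.
Proof.
apply/matrixP => i j; rewrite !mxE.
by case: (i == j); rewrite ?scale1r ?scale0r.
Qed.

(** The 1 x 1 matrix 1 is an irreducible unitary corepresentation, and a representative equivalent
    to it is a scalar conjugate of the identity, hence the identity. *)
Lemma trivial_class : exists a, u a = 1%:M.
Proof.
have unit1 : unitary_corep (1%:M : 'M[H]_1).
  split=> i j; rewrite !ord1 ?big_ord1 !mxE eqxx.
  - by rewrite rmorph1.
  - by have [->] := counit_monoid H.
  - by rewrite star1 antipode1.
have irr1 : irreducible_corep (1%:M : 'M[H]_1).
  split=> // m W v rW _; have := rank_leq_row W; rewrite rW.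
  by case: m {W v rW} => [|[|//]] _; [left|right].
have [a [[T [T' [_ T'T uT]]] _]] := irr_rep_complete unit1 irr1.
exists a; have: scalar_mx_in H T' *m scalar_mx_in H T = 1%:M.
  by rewrite -scalar_mx_inM T'T scalar_mx_in1.
by move=> sT; rewrite -[u a]mul1mx -sT -mulmxA -uT mul1mx.
Qed.

Lemma irr_rep_antipoder a : u a *m map_mx (@antipode _ H) (u a) = 1%:M.
Proof.
apply/matrixP => k l; rewrite !mxE; have [uD ue _] := irr_rep_unitary a.
under eq_bigr do rewrite mxE.
rewrite (antipoder_sum (uD k l)) ue.
by case: (k == l); rewrite ?scale1r ?scale0r.
Qed.

Lemma irr_rep_antipodel a : map_mx (@antipode _ H) (u a) *m u a = 1%:M.
Proof.
apply/matrixP => k l; rewrite !mxE; have [uD ue _] := irr_rep_unitary a.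
under eq_bigr do rewrite mxE.
rewrite (antipodel_sum (uD k l)) ue.
by case: (k == l); rewrite ?scale1r ?scale0r.
Qed.

(** The inverse of a gauge transformation is again linear over the base and colinear, so it has
    matrices, and these invert the given ones. Conversely, inverse matrices define the inverse
    map. *)
Lemma local_gaugeP (X : qpfb H) s (i : patch X)
    (g : tensor (patch_alg i) H -> tensor (patch_alg i) H) :
  local_gauge s g <-> exists b, [/\ has_matrix (@side_coeff s) s g b,
    forall a, mx_invertible (b a) & forall a, u a = 1%:M -> b a = 1%:M].
Proof.
have eP := side_coeff_comatrix_basis s.
split=> [[glin [g' gK g'K] gside gcol g1]|[b [gb binv b1]]].
  have gb := colinear_has_matrix eP glin gside gcol.
  set b := fun a => _ in gb.
  have g'lin : linear g'.
    by move=> k x y; apply: (can_inj gK); rewrite g'K glin !g'K.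
  have g'side (x : patch_alg i) z :
      g' (side_mul s (tens x (1 : H)) z) = side_mul s (tens x (1 : H)) (g' z).
    by apply: (can_inj gK); rewrite g'K gside g'K.
  have g'col z : tens_map g' idfun (right_coaction z) = right_coaction (g' z).
    (* With z = g (g' z), colinearity of [g] leaves (g' (x) id) o (g (x) id), which is the
       identity. *)
    rewrite -{1}[z]g'K -gcol; set w := right_coaction _.
    apply: (tens_ext (f := tens_map g' idfun \o tens_map g idfun) (g := id)) => //.
      by apply: comp_linear; exact: tens_map_idr_linear.
    by move=> x h /=; rewrite !tens_mapE//= gK.
  have g'b := colinear_has_matrix eP g'lin g'side g'col.
  set b' := fun a => _ in g'b.
  have bb' : forall a, side_mulmx s (b' a) (b a) = 1%:M.
    apply: (has_matrix_inj eP (has_matrix_comp gb g'b)).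
    by rewrite (_ : g \o g' = id); [exact: has_matrix_id|exact: funext].
  have b'b : forall a, side_mulmx s (b a) (b' a) = 1%:M.
    apply: (has_matrix_inj eP (has_matrix_comp g'b gb)).
    by rewrite (_ : g' \o g = id); [exact: has_matrix_id|exact: funext].
  exists b; split=> [//|a|a ua1].
    exists (b' a); move: (bb' a) (b'b a).
    by case: (s) => /= ? ?; split.
  (* In the trivial class the basis elements are scalars, so [g] and the identity agree on 1 (x)
     e_kl. *)
  rewrite -[b a](side_trK s) -[RHS](side_trK s) side_tr1.
  congr side_tr; apply: (tensor_comatrix_free eP) => k l.
  have [_ gE] := gb.
  have [_ idE] := @has_matrix_id _ _ _ _ (@side_coeff s) s (patch_alg i).
  have := gE 1 a k l; have := idE 1 a k l; rewrite side_tr1.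
  under eq_bigr do rewrite side_mul1l.
  move=> <-.
  under eq_bigr do rewrite side_mul1l.
  move=> <-; rewrite side_coeff1//.
  by rewrite (linear_funZ (tens_linearr _)) (linear_funZ glin) g1.
pose b' a := sval (cid (binv a)).
have b'P a : b a *m b' a = 1%:M /\ b' a *m b a = 1%:M.
  exact: svalP (cid (binv a)).
have [g' g'b'] := has_matrix_exists s eP b'.
have gK : cancel g g'.
  by apply: (has_matrix_cancel eP gb g'b') => a; have [] := b'P a; case: (s).
have g'K : cancel g' g.
  by apply: (has_matrix_cancel eP g'b' gb) => a; have [] := b'P a; case: (s).
have [glin gE] := gb.
split=> //; first by exists g'.
- exact: has_matrix_linear_side gb.
- exact: has_matrix_colinear gb.
move=> x; have [a ua1] := trivial_class.
have [a_gt0 _] := irr_rep_irreducible a.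
pose k := Ordinal a_gt0.
(* The unit of H is a diagonal entry of the trivial class, where the matrix of [g] is the
   identity. *)
have <- : side_coeff s k k = (1 : H) by rewrite side_coeff1// eqxx scale1r.
rewrite gE b1//.
by have [_ <-] := @has_matrix_id _ _ _ _ (@side_coeff s) s (patch_alg i).
Qed.

Lemma has_matrix_local_matrix (X : qpfb H) s (i : patch X)
    (g : tensor (patch_alg i) H -> tensor (patch_alg i) H) b :
  has_matrix (@side_coeff s) s g b -> local_matrix s g b.
Proof.
case: s => -[_ gE] a k l.
  have := gE 1 a k l => /= ->; apply: eq_bigr => m _.
  by rewrite /= mul1r.
(* The indices are swapped because [side_coeff Right] is transposed. *)
have := gE 1 a l k => /= ->; apply: eq_bigr => m _.
by rewrite /= mulr1 mxE.
Qed.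

End CompactQuantumGroup.

(** * Maps between quotients *)

Section QuotMap.

Context (K : fieldType) (A : pzAlgType K) (J L : ideal A).
Context (JL : forall x, J x -> L x).

Lemma quot_map_linear : linear (@quot_map _ _ J L).
Proof.
move=> k; elim/quot_ind=> x; elim/quot_ind=> y.
by rewrite -quot_piZ -quot_piD !quot_mapE// quot_piD quot_piZ.
Qed.

Lemma quot_map_monoid : monoid_morphism (@quot_map _ _ J L).
Proof.
split; first exact: quot_mapE.
elim/quot_ind=> x; elim/quot_ind=> y.
rewrite -(rmorphM (quot_proj J)) !quot_mapE//.
exact: (rmorphM (quot_proj L)).
Qed.

Definition quot_map_hom : alg_hom (quot J) (quot L) :=
  AlgHom quot_map_linear quot_map_monoid.

Lemma quot_map_surj : surj (@quot_map _ _ J L).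
Proof. by elim/quot_ind=> x; exists (quot_pi J x); rewrite quot_mapE. Qed.

End QuotMap.

Section IdealSumTheory.

Context (K : fieldType) (A : pzAlgType K) (J L : ideal A).

Lemma ideal_sum_left x : J x -> ideal_sum J L x.
Proof. by move=> Jx; exists x, 0; split=> //; [exact: ideal0|rewrite addr0]. Qed.

Lemma ideal_sum_right x : L x -> ideal_sum J L x.
Proof. by move=> Lx; exists 0, x; split=> //; [exact: ideal0|rewrite add0r]. Qed.

Lemma ideal_sumC x : ideal_sum L J x -> ideal_sum J L x.
Proof. by move=> [y [z [Ly Jz ->]]]; exists z, y; split=> //; rewrite addrC. Qed.

End IdealSumTheory.

(** * Transition maps and gluing along the covering *)

Section Gluing.

Context (K : fieldType) (H : hopf_algebra K) (X : qpfb H).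
Context (tau : transition_functions X).

Local Notation T i := (tensor (patch_alg (X := X) i) H).

Definition restr_hom (i j : patch X) : alg_hom (patch_alg i) (overlap_alg i j) :=
  quot_map_hom (@ideal_sum_left _ _ (base_ideal i) (base_ideal j)).

Definition restr'_hom (i j : patch X) : alg_hom (patch_alg j) (overlap_alg i j) :=
  quot_map_hom (@ideal_sum_right _ _ (base_ideal i) (base_ideal j)).

Definition flip_hom (i j : patch X) :
    alg_hom (overlap_alg j i) (overlap_alg i j) :=
  quot_map_hom (@ideal_sumC _ _ (base_ideal i) (base_ideal j)).

Lemma flipK (i j : patch X) (x : overlap_alg i j) : flip i j (flip j i x) = x.
Proof.
elim/quot_ind: x => x; rewrite /flip quot_mapE; last exact: ideal_sumC.
by rewrite quot_mapE//; exact: ideal_sumC.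
Qed.

Definition transition_map (i j : patch X) :
    tensor (overlap_alg i j) H -> tensor (overlap_alg i j) H :=
  tens_lift (fun (a : overlap_alg i j) (h : H) =>
    tens_lift (fun h1 h2 : H => tens (a * flip i j (tau j i h1)) h2) (comul H h)).

Lemma flip_tau_linear (i j : patch X) : linear (fun h => flip i j (tau j i h)).
Proof.
apply: (comp_linear (f := flip_hom i j)); exact: alg_hom_linear.
Qed.

Lemma transition_map_bilinear2 (i j : patch X) (a : overlap_alg i j) :
  bilinear_map (fun h1 h2 : H => tens (a * flip i j (tau j i h1)) h2).
Proof.
split=> [h|h] k x y /=; last exact: tens_linearr.
by rewrite flip_tau_linear mulrDr -alg_scalerAr [LHS]tens_linearl.
Qed.

Lemma transition_map_bilinear1 (i j : patch X) :
  bilinear_map (fun (a : overlap_alg i j) (h : H) =>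
    tens_lift (fun h1 h2 : H => tens (a * flip i j (tau j i h1)) h2) (comul H h)).
Proof.
split=> [h|a] k x y /=.
  rewrite /tens_lift scaler_sumr -big_split /=; apply: eq_bigr => -[h1 h2] _ /=.
  by rewrite mulrDl -alg_scalerAl [LHS]tens_linearl.
rewrite (alg_hom_linear (comul H)).
exact: (tens_lift_linear (transition_map_bilinear2 a)).
Qed.

Lemma transition_map_linear (i j : patch X) :
  linear (transition_map (i := i) (j := j)).
Proof. exact/tens_lift_linear/transition_map_bilinear1. Qed.

(** The values of the transition functions are central, so this one map fits both side
    conventions. *)
Lemma transition_map_has_matrix (C : eqType) (d : C -> nat)
    (e : forall a, 'I_(d a) -> 'I_(d a) -> H) (s : side) (i j : patch X) :
  comatrix_basis e -> has_matrix e s (transition_map (i := i) (j := j))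
    (fun a => side_tr s (\matrix_(k, l) flip i j (tau j i (e a k l)))).
Proof.
move=> [_ ecomul]; split=> [|x a k l]; first exact: transition_map_linear.
rewrite /transition_map (tens_liftE _ _ (transition_map_bilinear1 i j)) ecomul.
rewrite (linear_fun_sum _ _ (tens_lift_linear (transition_map_bilinear2 x))).
apply: eq_bigr => m _; rewrite (tens_liftE _ _ (transition_map_bilinear2 x)).
rewrite side_trK mxE side_mul_central// => z.
rewrite -[z]flipK; have fM := rmorphM (flip_hom i j).
by rewrite -[LHS]fM -[RHS]fM transition_central.
Qed.

Lemma triv_inj (p q : total_alg X) : (forall i, triv i p = triv i q) -> p = q.
Proof.
move=> pq; apply/eqP; rewrite -subr_eq0; apply/eqP.
apply: (triv_covering X).1 => i /=.
by rewrite /ker_set raddfB /= pq subrr.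
Qed.

(* x (x) h is sent to embed b * q, where b lifts x and triv i q = 1 (x) h.  On *)
(* the overlap this is well defined modulo ker (triv i) + ker (triv j), and    *)
(* composed with (restr (x) id) \o triv i it is the quotient map.              *)
Lemma overlap_ker (i j : patch X) p :
  tens_map (restr i j) idfun (triv i p) = 0 ->
  ideal_sum (ker_ideal (triv i)) (ker_ideal (triv j)) p.
Proof.
set N := ideal_sum _ _; move=> p0.
have [q qE] := choice (fun h : H =>
  @triv_surj _ _ X i (tens (1 : patch_alg i) h)).
pose psi (x : overlap_alg i j) (h : H) : quot N :=
  quot_pi N (embed X (repr x) * q h).
have Nembed b : overlap_ideal i j b -> N (embed X b).
  move=> [y [z [Jy Jz ->]]]; exists (embed X y), (embed X z).
  split; last exact: raddfD.
  - rewrite /= /ker_set triv_embed (_ : quot_pi _ y = 0).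
      exact: linear_fun0 (tens_linearl _).
    by apply/quot_piP; rewrite subr0.
  - rewrite /= /ker_set triv_embed (_ : quot_pi _ z = 0).
      exact: linear_fun0 (tens_linearl _).
    by apply/quot_piP; rewrite subr0.
have psiE b h : psi (quot_pi _ b) h = quot_pi N (embed X b * q h).
  apply/quot_piP; rewrite -mulrBl -(raddfB (embed X)).
  by apply: (@idealMr _ _ N); apply: Nembed; exact: quot_repr.
have psibil : bilinear_map psi.
  split=> [h|x] k y z.
    elim/quot_ind: y => y; elim/quot_ind: z => z; rewrite -quot_piZ -quot_piD.
    rewrite !psiE -quot_piZ -quot_piD (alg_hom_linear (embed X)).
    by rewrite mulrDl alg_scalerAl.
  rewrite /psi -quot_piZ -quot_piD alg_scalerAr -mulrDr.
  apply/quot_piP; rewrite -mulrBr; apply: (@idealMl _ _ N); apply: ideal_sum_left.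
  rewrite /= /ker_set raddfB /= (alg_hom_linear (triv i)) !qE.
  by rewrite tens_linearr subrr.
have psilin := tens_lift_linear psibil.
have rlin : linear (tens_map (restr i j) (@idfun H)).
  exact/tens_map_idr_linear/(alg_hom_linear (restr_hom i j)).
have lift z : exists2 p', triv i p' = z
    & tens_lift psi (tens_map (restr i j) idfun z) = quot_pi N p'.
  elim/tens_ind: z => [|x y [p1 <- p1E] [p2 <- p2E]|x h].
  - exists 0; first exact: raddf0.
    by rewrite (linear_fun0 rlin) (linear_fun0 psilin).
  - exists (p1 + p2); first exact: raddfD.
    by rewrite (linear_funD rlin) (linear_funD psilin) p1E p2E quot_piD.
  elim/quot_ind: x => b; exists (embed X b * q h).
    by rewrite rmorphM /= triv_embed qE tensM mulr1 mul1r.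
  rewrite tens_mapE//; last exact: (alg_hom_linear (restr_hom i j)).
  rewrite (tens_liftE _ _ psibil) /restr quot_mapE ?psiE//.
  exact: ideal_sum_left.
have [p' p'E] := lift (triv i p).
rewrite p0 (linear_fun0 psilin) => /esym/quot_piP; rewrite subr0 => Np'.
rewrite -(subrK p' p); apply: idealD => //; apply: ideal_sum_left.
by rewrite /= /ker_set raddfB /= p'E subrr.
Qed.

(** Each [g i (triv i p)] is lifted to the total algebra. Compatibility and [overlap_ker] put the
    difference of two lifts in the sum of the two kernels, and completeness of the covering gives a
    common lift. *)
Lemma gluing (g : forall i : patch X, T i -> T i) :
  (forall i j p, tens_map (restr i j) idfun (g i (triv i p))
     = transition_map (tens_map (restr' i j) idfun (g j (triv j p)))) ->
  exists f : total_alg X -> total_alg X, forall i, local_form f (g i).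
Proof.
move=> gcompat.
suff /choice[f fP] : forall p, exists p', forall i, triv i p' = g i (triv i p).
  by exists f => i p.
move=> p.
pose lift i := sval (cid (@triv_surj _ _ X i (g i (triv i p)))).
have liftE i : triv i (lift i) = g i (triv i p).
  exact: svalP (cid (@triv_surj _ _ X i (g i (triv i p)))).
have [|y yE] := (triv_covering X).2 (fun i => quot_pi _ (lift i)).
  move=> i j; rewrite quot_mapE; last exact: ideal_sum_left.
  rewrite quot_mapE; last exact: ideal_sum_right.
  apply/quot_piP; apply: overlap_ker.
  have rlin : linear (tens_map (restr i j) (@idfun H)).
    exact/tens_map_idr_linear/(alg_hom_linear (restr_hom i j)).
  rewrite raddfB /= (linear_funD rlin) -scaleN1r (linear_funZ rlin) scaleN1r.
  by rewrite liftE gcompat (transition_triv tau i j) liftE subrr.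
exists y => i; rewrite -liftE; have /quot_piP := yE i.
by rewrite /= /ker_set raddfB /= => /eqP; rewrite subr_eq0 => /eqP.
Qed.

End Gluing.

(** * The correspondence for global gauge transformations *)

(** The conjugate of C' is a left inverse of B and B' is a right inverse, so they coincide. *)
Lemma mx_conj_inv (R : pzRingType) n (M M' B B' C C' : 'M[R]_n) :
  M *m M' = 1%:M -> M' *m M = 1%:M -> B *m B' = 1%:M -> C' *m C = 1%:M ->
  B = M *m C *m M' -> B' = M *m C' *m M'.
Proof.
move=> MM' M'M BB' C'C BE.
have B1 : M *m C' *m M' *m B = 1%:M.
  by rewrite BE !mulmxA -(mulmxA _ M') M'M mulmx1 -(mulmxA _ C') C'C mulmx1.
by rewrite -[LHS]mul1mx -B1 -mulmxA BB' mulmx1.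
Qed.

Section GaugeCorrespondence.

Context (K : numClosedFieldType) (G : compact_quantum_group K).
Context (X : qpfb (cqg_poly G)) (tau : transition_functions X) (s : side).

Local Notation H := (cqg_poly G).
Local Notation u := (@irr_rep K G).
Local Notation T i := (tensor (patch_alg (X := X) i) H).
Local Notation E := (@side_coeff K G s).

Let eP : comatrix_basis E := side_coeff_comatrix_basis G s.

Definition transition_mx i j a : 'M[overlap_alg i j]_(irr_dim a) :=
  map_mx (tau i j) (u a).

Definition transition_mxV i j a : 'M[overlap_alg i j]_(irr_dim a) :=
  map_mx (fun h => flip i j (tau j i h)) (u a).

Lemma transition_mxVE i j a :
  transition_mxV i j a = map_mx (tau i j) (map_mx (@antipode _ H) (u a)).
Proof. by apply/matrixP => k l; rewrite !mxE transition_antipode. Qed.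

Lemma transition_mxK i j a : transition_mx i j a *m transition_mxV i j a = 1%:M.
Proof. by rewrite transition_mxVE -map_mxM irr_rep_antipoder map_mx1. Qed.

Lemma transition_mxVK i j a : transition_mxV i j a *m transition_mx i j a = 1%:M.
Proof. by rewrite transition_mxVE -map_mxM irr_rep_antipodel map_mx1. Qed.

(** The matrix of the transition map in the basis [E]. On the right, the antipode in [E] turns
    tau_ji back into tau_ij. *)
Definition side_transition i j a :=
  if s is Left then transition_mxV i j a else transition_mx i j a.

Lemma transition_map_side_transition i j :
  has_matrix E s (transition_map tau (i := i) (j := j)) (side_transition i j).
Proof.
have := transition_map_has_matrix tau s i j eP; congr has_matrix.
apply: functional_extensionality_dep => a.
apply/matrixP => k l; rewrite /side_transition.
case: (s); rewrite /= !mxE//.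
by rewrite -[tau j i _]transition_antipode flipK.
Qed.

Definition glued (b : mx_family X) i j a : Prop :=
  map_mx (restr i j) (b i a)
  = transition_mx i j a *m map_mx (restr' i j) (b j a) *m transition_mxV i j a.

Lemma gluedE (b : mx_family X) i j a : glued b i j a <-> forall k l,
  restr i j (b i a k l) = \sum_m \sum_n tau i j (u a k m)
    * restr' i j (b j a m n) * flip i j (tau j i (u a n l)).
Proof.
have mxE' k l : (transition_mx i j a *m map_mx (restr' i j) (b j a)
      *m transition_mxV i j a) k l
    = \sum_m \sum_n tau i j (u a k m) * restr' i j (b j a m n)
                    * flip i j (tau j i (u a n l)).
  rewrite mxE exchange_big; apply: eq_bigr => n _ /=.
  by rewrite !mxE mulr_suml; apply: eq_bigr => m _; rewrite !mxE.
split=> [/matrixP bE k l|bE]; first by rewrite -mxE' -bE mxE.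
by apply/matrixP => k l; rewrite mxE bE mxE'.
Qed.

Lemma glued_side (b : mx_family X) i j a : glued b i j a <->
  side_mulmx s (side_transition i j a) (map_mx (restr i j) (b i a))
  = side_mulmx s (map_mx (restr' i j) (b j a)) (side_transition i j a).
Proof.
rewrite /glued /side_transition.
have := transition_mxK i j a; have := transition_mxVK i j a.
move: (transition_mx i j a) (transition_mxV i j a) => M M' M'M MM'.
move: (map_mx _ _) (map_mx _ _) => B B'.
case: (s) => /=; split.
- by move=> ->; rewrite !mulmxA M'M mul1mx.
- by move=> BE; rewrite -mulmxA -BE mulmxA MM' mul1mx.
- by move=> ->; rewrite -(mulmxA _ M') M'M mulmx1.
- by move=> <-; rewrite -mulmxA MM' mulmx1.
Qed.

(** Write phi for the transition map and gi, gj for the maps induced on the overlap. Since the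
    restriction of chi_j is onto, compatibility means gi o phi = phi o gj, and comparing matrices
    gives [glued_side]. *)
Lemma compatibleP (g : forall i, T i -> T i) (b : mx_family X) i j :
  (forall i, has_matrix E s (g i) (b i)) ->
  (forall p, tens_map (restr i j) idfun (g i (triv i p))
    = transition_map tau (tens_map (restr' i j) idfun (g j (triv j p)))) <->
  (forall a, glued b i j a).
Proof.
move=> gb.
have [gi giP] := has_matrix_exists s eP (fun a => map_mx (restr_hom i j) (b i a)).
have [gj gjP] := has_matrix_exists s eP
  (fun a => map_mx (restr'_hom i j) (b j a)).
have giE := has_matrix_alg_hom eP (gb i) giP.
have gjE := has_matrix_alg_hom eP (gb j) gjP.
have phiP := transition_map_side_transition i j.
have giphi := has_matrix_comp giP phiP.
have phigj := has_matrix_comp phiP gjP.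
have lhsE p : tens_map (restr i j) idfun (g i (triv i p))
    = gi (transition_map tau (tens_map (restr' i j) idfun (triv j p))).
  by rewrite [LHS]giE; congr gi; exact: transition_triv.
split=> [gcompat a|bglued p].
  apply/glued_side; move: a; apply: (has_matrix_inj eP giphi).
  move: phigj; congr (has_matrix _ _ _ _); apply/esym/funext => w.
  have [z <-] : exists z, tens_map (restr' i j) idfun z = w.
    apply: tens_map_surj; first exact: (alg_hom_linear (restr'_hom i j)).
    exact/quot_map_surj/ideal_sum_right.
  have [p <-] := triv_surj z.
  by rewrite /= -lhsE gcompat; congr transition_map; exact: gjE.
have giphiE : gi \o transition_map tau (i := i) (j := j)
    =1 transition_map tau (i := i) (j := j) \o gj.
  apply: (has_matrix_funext eP giphi).
  move: phigj; congr has_matrix; apply: functional_extensionality_dep => a.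
  by have /glued_side := bglued a.
by rewrite lhsE [LHS]giphiE /=; congr transition_map; exact/esym/gjE.
Qed.

Lemma glued_inv (b b' : mx_family X) :
  (forall i a, b i a *m b' i a = 1%:M /\ b' i a *m b i a = 1%:M) ->
  forall i j a, glued b i j a -> glued b' i j a.
Proof.
move=> bb' i j a; rewrite /glued => bE.
have [/(congr1 (map_mx (restr_hom i j))) biK _] := bb' i a.
have [_ /(congr1 (map_mx (restr'_hom i j))) bjK] := bb' j a.
rewrite !map_mxM !map_mx1 in biK bjK.
exact: mx_conj_inv (transition_mxK i j a) (transition_mxVK i j a) biK bjK bE.
Qed.

(* The matrix entries are (id (x) counit) (g (1 (x) e_kl)), where g is the     *)
(* local form of f; they are computed on a lift of 1 (x) e_kl to total_alg X.  *)
Definition gauge_mx (f : total_alg X -> total_alg X) : mx_family X :=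
  fun i a => side_tr s (\matrix_(k, l)
    tens_lift (fun (x : patch_alg i) (h : H) => counit h *: x)
      (triv i (f (sval
        (cid (triv_surj (tens (1 : patch_alg i) (E (a := a) k l)))))))).

(** As chi_i o f = g o chi_i, the value computed on a lift is that of [g] at 1 (x) e_kl, whichever
    lift was chosen. *)
Lemma gauge_mx_has_matrix f i (g : T i -> T i) :
  local_gauge s g -> local_form f g -> has_matrix E s g (gauge_mx f i).
Proof.
move=> [glin _ gside gcol _] fg.
have := colinear_has_matrix eP glin gside gcol; congr has_matrix.
apply: functional_extensionality_dep => a; congr side_tr.
apply/matrixP => k l; rewrite !mxE fg.
by rewrite (svalP (cid (triv_surj (tens (1 : patch_alg i) (E (a := a) k l))))).
Qed.

Lemma gauge_local f : gauge X s f -> exists g : forall i, T i -> T i,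
  (forall i, local_gauge s (g i)) /\ (forall i, local_form f (g i)).
Proof.
move=> [_ _ _ fg].
have fg' i : exists g : T i -> T i, local_gauge s g /\ local_form f g.
  by have [g ? ?] := fg i; exists g.
exists (fun i => sval (cid (fg' i))).
by split=> i; have [] := svalP (cid (fg' i)).
Qed.

Lemma gauge_mx_gauge_matrices f : gauge X s f -> gauge_matrices tau (gauge_mx f).
Proof.
move=> /gauge_local[g [gauge_g fg]].
have gb i := gauge_mx_has_matrix (gauge_g i) (fg i).
have bP i : (forall a, mx_invertible (gauge_mx f i a)) /\
    (forall a, u a = 1%:M -> gauge_mx f i a = 1%:M).
  have [b [gb' binv b1]] := (local_gaugeP s (g i)).1 (gauge_g i).
  by have bE := has_matrix_inj eP (gb i) gb'; split=> a *; rewrite bE; auto.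
split=> [i|i j a|i].
- exact: (bP i).1.
- apply/gluedE; move: a; apply/compatibleP => p; first exact: gb.
  (* Compatibility of the local forms at [p] is the transition identity at the point [f p]. *)
  by rewrite -!fg; exact: transition_triv.
- exact: (bP i).2.
Qed.

Lemma gauge_mx_inj f f' : gauge X s f -> gauge X s f' ->
  gauge_mx f = gauge_mx f' -> f = f'.
Proof.
move=> /gauge_local[g [gauge_g fg]] /gauge_local[g' [gauge_g' fg']] bE.
apply: funext => p; apply: triv_inj => i; rewrite fg fg'.
apply: (has_matrix_funext eP (gauge_mx_has_matrix (gauge_g i) (fg i))).
by rewrite bE; exact: gauge_mx_has_matrix.
Qed.

(** The local maps with matrices [b] are glued to [f]; every property of [f] is then checked patch
    by patch, by joint injectivity of the chi_i. *)
Lemma gauge_mx_surj b : gauge_matrices tau b ->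
  exists2 f, gauge X s f & gauge_mx f = b.
Proof.
move=> [binv bglued b1].
pose b' i a := sval (cid (binv i a)).
have bb' i a : b i a *m b' i a = 1%:M /\ b' i a *m b i a = 1%:M.
  exact: svalP (cid (binv i a)).
pose g i := sval (cid (has_matrix_exists s eP (b i))).
have gb i : has_matrix E s (g i) (b i).
  exact: svalP (cid (has_matrix_exists s eP (b i))).
pose g' i := sval (cid (has_matrix_exists s eP (b' i))).
have g'b' i : has_matrix E s (g' i) (b' i).
  exact: svalP (cid (has_matrix_exists s eP (b' i))).
have gauge_g i : local_gauge s (g i).
  apply/local_gaugeP; exists (b i).
  by split; [exact: gb|exact: binv|exact: b1].
have glued_b i j a : glued b i j a by apply/gluedE; exact: bglued.
have [f fg] := gluing (fun i j => (compatibleP i j gb).2 (glued_b i j)).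
(* The inverse matrices satisfy the same gluing condition, and their glued map will be the inverse
   of [f]. *)
have [f' f'g'] := gluing (fun i j => (compatibleP i j g'b').2
  (fun a => glued_inv bb' (glued_b i j a))).
have gauge_f : gauge X s f.
  split.
  - move=> k p q; apply: triv_inj => i; have [glin _ _ _ _] := gauge_g i.
    by rewrite fg !(alg_hom_linear (triv i)) glin !fg.
  - exists f' => p; apply: triv_inj => i.
      rewrite f'g' fg (has_matrix_cancel eP (gb i) (g'b' i))// => a.
      by have [] := bb' i a; case: (s).
    rewrite fg f'g' (has_matrix_cancel eP (g'b' i) (gb i))// => a.
    by have [] := bb' i a; case: (s).
  - move=> c p; apply: triv_inj => i; have [_ _ gside _ _] := gauge_g i.
    by rewrite fg !alg_hom_side_mul triv_embed gside fg.
  - by move=> i; exists (g i).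
exists f => //; apply: functional_extensionality_dep => i.
apply: functional_extensionality_dep => a.
exact: (has_matrix_inj eP (gauge_mx_has_matrix (gauge_g i) (fg i)) (gb i)).
Qed.

End GaugeCorrespondence.

Theorem proposition9 (R : realType) (G : compact_quantum_group R[i])
    (X : qpfb (cqg_poly G)) (tau : transition_functions X) (s : side) :
  exists F : (total_alg X -> total_alg X) -> mx_family X,
    set_bij (gauge X s) (gauge_matrices tau) F /\
    (forall f, gauge X s f ->
       forall i g, local_gauge s g -> local_form f g -> local_matrix s g (F f i)).
Proof.
exists (@gauge_mx R[i] G X s); split; last first.
  move=> f _ i g gauge_g fg; apply: has_matrix_local_matrix.
  exact: gauge_mx_has_matrix.
split.
- by move=> f; exact: gauge_mx_gauge_matrices.
- by move=> f f' /set_mem fG /set_mem f'G; exact: gauge_mx_inj.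
- by move=> b /(gauge_mx_surj s)[f fG fb]; exists f.
Qed.
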